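(* Suppose $E:\mathcal{P}_{2,\omega_0}(\mathbb{R}^d)\to\mathbb{R}\cup\{+\infty\}$ is proper, coercive, lower semicontinuous and $\lambda$-convex along generalized geodesics for some $\lambda\in\mathbb{R}$. Then for $\mu\in D(|\partial E|)$, $0<h\le\tau<\frac1{\lambda^-}$ and integers $n,m\ge1$, $$(1-\lambda^-h)^2W_2^2(J^n_\tau\mu,J^m_h\mu)\le\frac h\tau(1-\lambda^-\tau)^{-1}W_2^2(J^{n-1}_\tau\mu,J^{m-1}_h\mu)+\frac{\tau-h}{\tau}W_2^2(J^{m-1}_h\mu,J^n_\tau\mu)+2h^2(1-\lambda^-h)^{-2m}|\partial E|^2(\mu).$$
   Context: Fix a probability measure $\omega_0$ on $\mathbb{R}^d$. $W_2$ is the quadratic Wasserstein distance, $\Gamma_0(\mu,\nu)$ the optimal couplings; $\mathcal{P}_{2,\omega_0}(\mathbb{R}^d)=\{\mu:W_2(\mu,\omega_0)<\infty\}$. A transport plan from $\mu_0$ to $\mu_1$ with base $\omega$ is $\boldsymbol\omega\in\mathcal{P}((\mathbb{R}^d)^3)$ with $\pi^{1,2}\#\boldsymbol\omega\in\Gamma_0(\omega,\mu_0)$, $\pi^{1,3}\#\boldsymbol\omega\in\Gamma_0(\omega,\mu_1)$; generalized geodesic $\mu_\alpha=((1-\alpha)\pi^2+\alpha\pi^3)\#\boldsymbol\omega$; $W_{2,\boldsymbol\omega}(\mu_0,\mu_1)=(\int|x_2-x_3|^2d\boldsymbol\omega)^{1/2}$. $D(E)=\{E<\infty\}$; proper: $D(E)\ne\emptyset$;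 coercive: $\exists\tau_0>0,u_0$ with $\inf_v\{\frac1{2\tau_0}W_2^2(u_0,v)+E(v)\}>-\infty$; lower semicontinuous w.r.t. $W_2$; $\lambda$-convex along generalized geodesics: for all $\mu_0,\mu_1,\omega$ there is a generalized geodesic from $\mu_0$ to $\mu_1$ with base $\omega$ (induced by some $\boldsymbol\omega$) with $E(\mu_\alpha)\le(1-\alpha)E(\mu_0)+\alpha E(\mu_1)-\alpha(1-\alpha)\frac\lambda2W^2_{2,\boldsymbol\omega}(\mu_0,\mu_1)$. $\lambda^-=\max\{0,-\lambda\}$, $1/\lambda^-=+\infty$ if $\lambda^-=0$. $J_\tau\mu=\operatorname{argmin}_\nu\{\frac1{2\tau}W_2^2(\mu,\nu)+E(\nu)\}$ (well defined for $\mu$ in the $W_2$-closure of $D(E)$ and $0<\tau<1/\lambda^-$), $J^n_\tau$ its $n$-fold iterate, $J^0_\tau\mu=\mu$. Metric slope $|\partial E|(\mu)=\limsup_{\nu\to\mu}(E(\mu)-E(\nu))^+/W_2(\mu,\nu)$; $D(|\partial E|)=\{\mu\in D(E):|\partial E|(\mu)<\infty\}$. *)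

(* Defs.v *)
From HB Require Import structures.
From Stdlib Require Import ClassicalEpsilon.
From mathcomp Require Import all_boot all_order all_algebra.
From mathcomp Require Import all_classical all_reals all_analysis.
Set Implicit Arguments. Unset Strict Implicit. Unset Printing Implicit Defensive.
Import Order.TTheory GRing.Theory Num.Theory.
Import numFieldNormedType.Exports.
Local Open Scope classical_set_scope.
Local Open Scope ring_scope.

Definition Rd (R : realType) (d : nat) :=
  g_sigma_algebraType (@open 'rV[R]_d).
HB.instance Definition _ (R : realType) (d : nat) :=
  Measurable.on (Rd R d).

(* squared Euclidean distance |x - y|^2 (note: mathcomp's matrix norm is the
   sup norm, so we write the Euclidean one explicitly) *)
Definition sqdist (R : realType) (d : nat) (x y : Rd R d) : R :=
  \sum_(i < d) (x ord0 i - y ord0 i) ^+ 2.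

Section Wasserstein.
Variables (R : realType) (d : nat).
Local Notation T := (Rd R d).
Local Notation prob X := (probability X R).

Definition coupling (g : prob (T * T)%type) (mu nu : prob T) : Prop :=
  forall A : set T, measurable A ->
    g (A `*` setT) = mu A /\ g (setT `*` A) = nu A.

Definition cost (g : prob (T * T)%type) : \bar R :=
  (\int[g]_z (sqdist z.1 z.2)%:E)%E.

Definition W2sq (mu nu : prob T) : \bar R :=
  ereal_inf [set c | exists g : prob (T * T)%type, coupling g mu nu /\ c = cost g].

Definition W2 (mu nu : prob T) : \bar R :=
  if W2sq mu nu == +oo%E then +oo%E else (Num.sqrt (fine (W2sq mu nu)))%:E.

Definition optimal_coupling (g : prob (T * T)%type) (mu nu : prob T) : Prop :=
  coupling g mu nu /\ cost g = W2sq mu nu.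

Definition P2 (om0 : prob T) (mu : prob T) : Prop := (W2sq mu om0 < +oo)%E.

Definition is_push (X Y : Type) (mX : set (set X)) (m1 : set X -> \bar R)
  (f : X -> Y) (mY : set (set Y)) (m2 : set Y -> \bar R) : Prop :=
  forall A, mY A -> m2 A = m1 (f @^-1` A).

Definition pi12 (x : (T * T) * T) : T * T := (x.1.1, x.1.2).
Definition pi13 (x : (T * T) * T) : T * T := (x.1.1, x.2).

Definition transport_plan (w : prob ((T * T) * T)%type) (om mu0 mu1 : prob T) : Prop :=
  (exists g12 : prob (T * T)%type, optimal_coupling g12 om mu0 /\
     is_push measurable w pi12 measurable g12) /\
  (exists g13 : prob (T * T)%type, optimal_coupling g13 om mu1 /\
     is_push measurable w pi13 measurable g13).

Definition geod_map (a : R) (x : (T * T) * T) : T :=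
  ((1 - a) *: (x.1.2 : 'rV[R]_d) + a *: (x.2 : 'rV[R]_d)).

Definition W2plan_sq (w : prob ((T * T) * T)%type) : \bar R :=
  (\int[w]_x (sqdist x.1.2 x.2)%:E)%E.

Section Functional.
Variables (om0 : prob T) (E : prob T -> \bar R).

Definition is_proper : Prop := exists mu, P2 om0 mu /\ (E mu < +oo)%E.

Definition is_coercive : Prop :=
  exists tau0 : R, 0 < tau0 /\ exists u0, P2 om0 u0 /\
    (-oo < ereal_inf [set c | exists v, P2 om0 v /\
        c = ((2 * tau0)^-1)%:E * W2sq u0 v + E v])%E.

(* lower semicontinuity w.r.t. W2 (sequential, W2 being an (extended) metric) *)
Definition is_W2_lsc : Prop :=
  forall (u : nat -> prob T) (mu : prob T), P2 om0 mu -> (forall n, P2 om0 (u n)) ->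
    W2 (u n) mu @[n --> \oo] --> 0%E ->
    (E mu <= limn_einf (fun n => E (u n)))%E.

Definition is_convex_gen_geod (lam : R) : Prop :=
  forall mu0 mu1 om : prob T, P2 om0 mu0 -> P2 om0 mu1 -> P2 om0 om ->
  exists w : prob ((T * T) * T)%type, transport_plan w om mu0 mu1 /\
    forall a : R, 0 <= a <= 1 ->
      exists mua : prob T, is_push measurable w (geod_map a) measurable mua /\
        (E mua <= (1 - a)%:E * E mu0 + a%:E * E mu1
                  - (a * (1 - a) * lam / 2)%:E * W2plan_sq w)%E.

(* metric slope |dE|(mu) = limsup_{nu -> mu} (E mu - E nu)^+ / W2(mu, nu)
   (nu ranging over P_{2,om0} \ {mu}; the value 0 is included in the sup so that
   the slope is 0 at an isolated point) *)
Definition slope (mu : prob T) : \bar R :=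
  ereal_inf [set s | exists r : R, 0 < r /\
    s = ereal_sup ([set 0%E] `|` [set q | exists nu, P2 om0 nu /\
           (0 < W2 mu nu)%E /\ (W2 mu nu < r%:E)%E /\
           q = (maxe (E mu - E nu) 0 * ((fine (W2 mu nu))^-1)%:E)%E])].

Definition is_argmin (tau : R) (mu nu : prob T) : Prop :=
  P2 om0 nu /\ forall nu', P2 om0 nu' ->
    (((2 * tau)^-1)%:E * W2sq mu nu + E nu
      <= ((2 * tau)^-1)%:E * W2sq mu nu' + E nu')%E.

Definition J (tau : R) (mu : prob T) : prob T :=
  epsilon (inhabits mu) (is_argmin tau mu).

Definition Jn (tau : R) (n : nat) (mu : prob T) : prob T := iter n (J tau) mu.

End Functional.

Definition lam_minus (lam : R) : R := Num.max 0 (- lam).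

End Wasserstein.

(* Main.v *)
(** Idea. Write [k = lam_minus lam]. Comparing [J_t u] with a generalized geodesic
    based at [u] gives the discrete variational inequality
      (1 - k t) W^2(J_t u, v) <= W^2(u, v) - W^2(u, J_t u) + 2 t (E v - E (J_t u)).
    With [v] the old point it yields the decay of the slope along the scheme, and the
    theorem is the sum of the inequality for [J_h y'] at [v = J_t x'] and of [h / t] times
    the inequality for [J_t x'] at [v = y']: the energies telescope to [E y' - E (J_h y')],
    which the slope of [y'] controls, and the remaining term [k h^2 / t W^2(y', J_t x')] is
    absorbed by [W^2(x', y')] and [W^2(x', J_t x')].

    Minimizers exist because minimizing sequences are Cauchy and W2 is complete.
    Disintegration is avoided throughout: couplings are glued along countable partitions
    into small cells, and a Cauchy sequence of measures is realized, up to small errors,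
    by the states of a countable Markov chain built on [0, 1] by nested intervals; the
    law of the almost sure limit of these states is the limit measure. *)
From HB Require Import structures.
Require Import Defs.
From mathcomp Require Import all_boot all_order all_algebra.
From mathcomp Require Import all_classical all_reals all_analysis.
From mathcomp Require Import measurable_realfun giry ring lra.
Set Implicit Arguments. Unset Strict Implicit. Unset Printing Implicit Defensive.
Import Order.TTheory GRing.Theory Num.Theory.
Import numFieldNormedType.Exports.
Local Open Scope classical_set_scope.
Local Open Scope ring_scope.

(** The metric half works with a real-valued [D] on [Dom], later the measures of [P2 om0] with
    finite energy, and what it knows of interpolation is [gen_geod]. Gluing along cells only brings
    the middle points of two couplings close together, so it yields [W2sq_quasi_triangle], with a
    multiplicative and an additive error: enough for finiteness, too weak for sharp inequalities.
    The exact triangle inequality, which the decay of the slope and the final absorption need, comes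
    from convexity instead: the squared distance from the base to an interpolant is nonnegative for
    every parameter ([dist_triangle]). The same hypothesis supplies optimal couplings, as marginals
    of transport plans, and geodesics issuing from a point. These turn the local slope into the
    global bound [slope_le], and coercivity at one step size into a lower bound for every [t] with
    [k * t < 1]. *)

(** Stands in for the limit [a] to 0. If [K < Y], then [a = 1] forces [0 <= K], and the [a] for
    which [(1 - a) * Y] is the midpoint of [K] and [Y] gives a contradiction. *)
Lemma le_of_shrink_le (R : realType) (Y K : R) :
  (forall a, 0 < a <= 1 -> (1 - a) * Y <= K) -> Y <= K.
Proof.
move=> YK; rewrite leNgt; apply/negP => KY.
have K0 : 0 <= K by have := YK 1; rewrite ltr01 lexx subrr mul0r; exact.
have Y0 : 0 < Y by apply: le_lt_trans KY.
have := YK ((Y - K) / (2 * Y)).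
have -> : (1 - (Y - K) / (2 * Y)) * Y = (Y + K) / 2 by field; rewrite gt_eqF.
have -> : 0 < (Y - K) / (2 * Y) <= 1.
  by rewrite divr_gt0 ?subr_gt0 ?mulr_gt0//= ler_pdivrMr ?mulr_gt0//; lra.
by move=> /(_ isT); lra.
Qed.

(** * The proximal scheme for an abstract squared distance and energy *)

Section proximal_scheme.
Context {R : realType} {M : Type}.
Variables (Dom : M -> Prop) (D : M -> M -> R) (e : M -> R) (lam : R).
Hypothesis D_ge0 : forall x y, 0 <= D x y.
Hypothesis D_sym : forall x y, D x y = D y x.
Hypothesis D_diag : forall x, D x x = 0.
(** [Dw] is the squared length of the transport plan: one value for all [a], possibly larger than
    [D x y]. The last bound is the Euclidean identity for |o - ((1 - a) x + a y)|^2, integrated. *)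
Hypothesis gen_geod : forall o x y, Dom o -> Dom x -> Dom y ->
  exists2 Dw, D x y <= Dw & forall a : R, 0 <= a <= 1 -> exists z,
    [/\ Dom z, e z <= (1 - a) * e x + a * e y - a * (1 - a) * lam / 2 * Dw
      & D o z <= (1 - a) * D o x + a * D o y - a * (1 - a) * Dw].

Let k := lam_minus lam.
Local Notation dist x y := (Num.sqrt (D x y)).

Definition is_prox (t : R) (u z : M) : Prop := Dom z /\
  forall v, Dom v -> (2 * t)^-1 * D u z + e z <= (2 * t)^-1 * D u v + e v.

(** For a [-k]-convex energy this global inequality is equivalent to the metric slope being at most
    [s]; it propagates along the scheme without any limsup. *)
Definition slope_le (u : M) (s : R) : Prop := 0 <= s /\
  forall v, Dom v -> e u - e v <= s * dist u v + k / 2 * D u v.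

Lemma lam_minus_ge0 : 0 <= k.
Proof. by rewrite /k /lam_minus le_max lexx. Qed.

Lemma lam_minus_geN : - lam <= k.
Proof. by rewrite /k /lam_minus le_max lexx orbT. Qed.

Lemma dist_sq x y : dist x y ^+ 2 = D x y.
Proof. exact: sqr_sqrtr. Qed.

(* The hypothesis says that interpolants have nonnegative squared distance to the
   base point; the optimal parameter is [a = A / (A + B)]. *)
Lemma le_sqr_addr_of_interp (A B X : R) : 0 <= A -> 0 <= B ->
  (forall a, 0 <= a <= 1 -> a * (1 - a) * X <= (1 - a) * A ^+ 2 + a * B ^+ 2) ->
  X <= (A + B) ^+ 2.
Proof.
move=> A0 B0 XAB.
(* Both numbers are enlarged by [d] so that the optimal parameter makes sense when [A + B = 0]; [d]
   is sent to 0 at the end. *)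
have XABd d : 0 < d -> X <= (A + B + d * 2) ^+ 2.
  move=> d0; pose A' := A + d; pose B' := B + d.
  have AB0 : 0 < A' + B' by rewrite /A' /B'; lra.
  have := XAB (A' / (A' + B')).
  have -> : 0 <= A' / (A' + B') <= 1.
    rewrite divr_ge0 ?(ltW AB0) ?ler_pdivrMr//= /A' /B'; lra.
  move=> /(_ isT).
  have -> : 1 - A' / (A' + B') = B' / (A' + B') by field; rewrite gt_eqF.
  have -> : A' / (A' + B') * (B' / (A' + B')) * X = A' * B' * X / (A' + B') ^+ 2.
    by field; rewrite gt_eqF.
  have -> : B' / (A' + B') * A ^+ 2 + A' / (A' + B') * B ^+ 2 =
      (B' * A ^+ 2 + A' * B ^+ 2) * (A' + B') / (A' + B') ^+ 2.
    by field; rewrite gt_eqF.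
  rewrite ler_pM2r ?invr_gt0 ?exprn_gt0// => H.
  have A'0 : 0 < A' by rewrite /A'; lra.
  have B'0 : 0 < B' by rewrite /B'; lra.
  have -> : A + B + d * 2 = A' + B' by rewrite /A' /B'; ring.
  rewrite -(@ler_pM2l _ (A' * B')) ?mulr_gt0//.
  apply: le_trans H _; rewrite (expr2 (A' + B')) [leRHS]mulrA ler_pM2r//.
  rewrite mulrDr; apply: lerD.
    rewrite (mulrC A') -mulrA; apply: ler_wpM2l; first exact: ltW.
    by rewrite expr2 ler_pM// /A'; lra.
  rewrite -mulrA; apply: ler_wpM2l; first exact: ltW.
  by rewrite expr2 ler_pM// /B'; lra.
apply/ler_addgt0Pr => eps eps0.
pose d := eps / (4 * (A + B) + 4 + eps).
have den : 0 < 4 * (A + B) + 4 + eps by lra.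
have d0 : 0 < d by rewrite divr_gt0.
have d1 : d <= 1 by rewrite /d ler_pdivrMr//; lra.
apply: le_trans (XABd _ d0) _.
have -> : (A + B + d * 2) ^+ 2 = (A + B) ^+ 2 + d * (4 * (A + B) + 4 * d) by ring.
rewrite lerD2l.
have dE : d * (4 * (A + B) + 4 + eps) = eps by rewrite /d divfK// gt_eqF.
by rewrite -[leRHS]dE; apply: ler_wpM2l; [exact: ltW|lra].
Qed.

(** The geodesic joins [x] to [z] and its base is the middle point [y]. *)
Lemma dist_triangle x y z : Dom x -> Dom y -> Dom z ->
  D x z <= (dist x y + dist y z) ^+ 2.
Proof.
move=> dx dy dz; have [Dw xzDw H] := gen_geod dy dx dz.
apply: le_trans xzDw _; rewrite -D_sym.
apply: le_sqr_addr_of_interp; rewrite ?sqrtr_ge0// !dist_sq.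
move=> a a01; have [v [_ _ yv]] := H a a01; have := D_ge0 y v; lra.
Qed.

(** In the comparison with the interpolant every term carries a factor [a]; dividing by it and
    letting [a] go to 0 leaves [(1 + lam * t) * Dw] on the left. As [1 + lam * t >= 1 - k * t > 0],
    [Dw] may then be lowered to [D z v]. *)
Lemma prox_evi t u z v : 0 < t -> k * t < 1 -> Dom u -> is_prox t u z -> Dom v ->
  (1 - k * t) * D z v <= D u v - D u z + 2 * t * (e v - e z).
Proof.
move=> t0 kt du [dz zmin] dv; have [Dw zvDw H] := gen_geod du dz dv.
have t20 : 0 < 2 * t by rewrite mulr_gt0.
have step a : 0 < a <= 1 ->
    (1 - a) * ((1 + lam * t) * Dw) <= D u v - D u z + 2 * t * (e v - e z).
  case/andP=> a0 a1; have a01 : 0 <= a <= 1 by rewrite (ltW a0).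
  have [za [dza eza Dza]] := H a a01.
  have zle := ler_wpM2l (ltW t20) (zmin _ dza).
  have {}eza := ler_wpM2l (ltW t20) eza.
  rewrite !mulrDr !mulrA !divff ?gt_eqF// !mul1r in zle.
  rewrite -(ler_pM2l a0); lra.
apply: le_trans (le_of_shrink_le step).
have := lam_minus_geN; have := lam_minus_ge0 => k0 kN.
have : (1 - k * t) * D z v <= (1 - k * t) * Dw by apply: ler_wpM2l => //; lra.
move=> /le_trans; apply; apply: ler_wpM2r; first exact: le_trans (D_ge0 z v) zvDw.
have : 0 <= (lam + k) * t by apply: mulr_ge0; [lra|exact: ltW].
lra.
Qed.

(** [prox_evi] at [v = u] bounds [(2 - k * t) * w ^+ 2] by [2 * t * (e u - e z)], where
    [w = dist u z]; the quadratic part of [slope_le] moves to the left, and a factor [2 * w]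
    cancels. *)
Lemma prox_dist_le t u z s : 0 < t -> k * t < 1 -> Dom u -> is_prox t u z ->
  slope_le u s -> dist u z <= t * (s / (1 - k * t)).
Proof.
move=> t0 kt du pz [s0 us]; have dz := pz.1.
have := prox_evi t0 kt du pz du; rewrite D_diag (D_sym z u).
have /(ler_wpM2l (ltW t0)) := us _ dz; have := dist_sq u z.
move: (dist u z) (sqrtr_ge0 (D u z)) => w w0 <- H1 H2.
have kt1 : 0 < 1 - k * t by rewrite subr_gt0.
rewrite mulrA ler_pdivlMr//.
have [->|wN0] := eqVneq w 0; first by rewrite mul0r mulr_ge0// ltW.
have {wN0} w0 : 0 < w by rewrite lt_def wN0.
rewrite -(ler_pM2l w0); lra.
Qed.

(** In [prox_evi], the triangle inequality bounds [D u v - D u z] by [2 * w * b + b ^+ 2], with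
    [w = dist u z] and [b = dist z v]. The square combines with [(1 - k * t) * b ^+ 2] into
    [k * t * b ^+ 2], and [prox_dist_le] bounds [w]. *)
Lemma prox_slope_le t u z s : 0 < t -> k * t < 1 -> Dom u -> is_prox t u z ->
  slope_le u s -> slope_le z (s / (1 - k * t)).
Proof.
move=> t0 kt du pz us; have dz := pz.1.
have kt1 : 0 < 1 - k * t by rewrite subr_gt0.
have s'0 : 0 <= s / (1 - k * t) by rewrite divr_ge0 ?(ltW kt1)// us.1.
split=> // v dv; have := prox_evi t0 kt du pz dv.
have := dist_triangle du dz dv; have := dist_sq u z; have := dist_sq z v.
have := prox_dist_le t0 kt du pz us.
move: (dist z v) (sqrtr_ge0 (D z v)) (dist u z) (sqrtr_ge0 (D u z)).
move: (s / _) s'0 => s' s'0 b b0 w w0 H <- <- H1 H2.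
have H3 : w * b <= t * s' * b by apply: ler_wpM2r.
rewrite -(@ler_pM2l _ (2 * t)) ?mulr_gt0//; lra.
Qed.

Lemma asymmetric_recursion h t x' x y' y s : 0 < h -> h <= t -> k * t < 1 ->
  Dom x' -> Dom y' -> is_prox t x' x -> is_prox h y' y -> slope_le y' s ->
  (1 - k * h) ^+ 2 * D x y <= h / t * (1 - k * t)^-1 * D x' y' +
     (t - h) / t * D y' x + h ^+ 2 * s ^+ 2.
Proof.
move=> h0 ht kt dx' dy' px py y's; have [dx dy] := (px.1, py.1).
have t0 : 0 < t by apply: lt_le_trans ht.
have k0 := lam_minus_ge0.
have kht : k * h <= k * t by apply: ler_wpM2l.
have kh : k * h < 1 by apply: le_lt_trans kt.
have evx := prox_evi t0 kt dx' px dy'; have evy := prox_evi h0 kh dy' py dx.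
have tri := dist_triangle dy' dx' dx.
have := (dist_sq y' x', dist_sq x' x, dist_sq y' y) => -[[sqA sqB] sqw].
have [s0 /(_ _ dy) sle] := y's.
have A0 := sqrtr_ge0 (D y' x'); have B0 := sqrtr_ge0 (D x' x).
have w0 := sqrtr_ge0 (D y' y).
rewrite (D_sym x' y'); rewrite (D_sym x' y') (D_sym x y') in evx.
rewrite (D_sym y x) in evy.
move: (dist y' x') (dist x' x) (dist y' y) A0 B0 w0 sqA sqB sqw tri sle.
move=> A B w A0 B0 w0 sqA sqB sqw; rewrite -sqA -sqB -sqw in evx evy *.
move=> tri sle.
pose a := k * h; pose b := k * t.
pose r := h / t; have r0 : 0 < r by rewrite divr_gt0.
have rt : r * t = h by rewrite divfK// gt_eqF.
have a0 : 0 <= a by rewrite mulr_ge0// ltW.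
have a1 : 0 < 1 - a by rewrite subr_gt0.
have b1 : 0 < 1 - b by rewrite subr_gt0.
have ab : a <= b by [].
have rb : r * b = a by rewrite /a /b mulrCA rt.
have r1 : r <= 1 by rewrite ler_pdivrMr ?mul1r.
have -> : (t - h) / t = 1 - r by rewrite /r; field; rewrite gt_eqF.
rewrite -/a -/b -/r.
have {evx} evx : r * (1 - b) * D y' x <= r * A ^+ 2 - r * B ^+ 2 + 2 * h * (e y' - e x).
  have := ler_wpM2l (ltW r0) evx; rewrite -/b => H.
  have -> : 2 * h = r * (2 * t) by rewrite mulrCA rt.
  by lra.
have {}evx : (r - a) * D y' x <= r * A ^+ 2 - r * B ^+ 2 + 2 * h * (e y' - e x).
  by rewrite -rb; apply: le_trans evx; lra.
have {evy} evy : (1 - a) * D x y <= D y' x - w ^+ 2 + 2 * h * (e x - e y) by [].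
have {sle} sle : 2 * h * (e y' - e y) <= 2 * h * s * w + a * w ^+ 2.
  have := ler_wpM2l (ltW (_ : 0 < 2 * h)) sle; rewrite mulr_gt0// => /(_ isT) H.
  by apply: le_trans H _; rewrite /a; lra.
have H1 : (1 - a) * D x y <= (1 - r + a) * D y' x + r * A ^+ 2 - r * B ^+ 2
    + 2 * h * s * w - (1 - a) * w ^+ 2 by lra.
(* The factor [1 - a] makes the terms in [w] a difference [2 * p * q - p ^+ 2] with
   [p = (1 - a) * w] and [q = h * s], hence at most [q ^+ 2]. *)
have H2 := ler_wpM2l (ltW a1) H1.
have H3 : 2 * ((1 - a) * w) * (h * s) <= ((1 - a) * w) ^+ 2 + (h * s) ^+ 2.
  by have := sqr_ge0 ((1 - a) * w - h * s); lra.
have H4 : (1 - a) ^+ 2 * D x y <= (1 - r) * D y' x + a * r * (1 - b) * D y' x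
    + (1 - a) * r * A ^+ 2 - (1 - a) * r * B ^+ 2 + h ^+ 2 * s ^+ 2.
  (* Here [(1 - a) * (1 - r + a) = (1 - r) + a * (r - a)], and [r - a = r * (1 - b)] because
     [r * b = a]. *)
  have -> : a * r * (1 - b) * D y' x = a * (r - a) * D y' x by rewrite -rb; ring.
  by lra.
(* The weights [a] and [1 - a] are those that, after multiplication by [r], cancel the [B ^+ 2] term
   of [H4] and complete its [A ^+ 2] term to [r * A ^+ 2]. *)
have H5 : a * (A + B) ^+ 2 * (1 - a) <= a * A ^+ 2 + (1 - a) * B ^+ 2.
  by have := sqr_ge0 (a * A - (1 - a) * B); lra.
have H6 : a * (1 - b) * D y' x <= a * A ^+ 2 + (1 - a) * B ^+ 2.
  apply: le_trans H5; rewrite mulrAC; apply: ler_pM.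
  - exact: mulr_ge0.
  - exact: ltW.
  - exact: ler_wpM2l.
  - by lra.
have H7 : 1 <= (1 - b)^-1 by rewrite -invr1 lef_pV2 ?posrE//; lra.
have /(ler_wpM2l (ltW r0)) H8 := H6.
have H9 : r * A ^+ 2 <= r * (1 - b)^-1 * A ^+ 2.
  by rewrite -mulrA; apply: ler_wpM2l; [exact: ltW|rewrite ler_peMl ?sqr_ge0].
lra.
Qed.

(** When the base is the starting point, [0 <= D u z] reads [(1 - a) * Dw <= D u v] after division
    by [a], so [Dw] equals [D u v] and the interpolants lie on a true geodesic. *)
Lemma geod_from_base u v : Dom u -> Dom v -> forall a, 0 <= a <= 1 -> exists z,
  [/\ Dom z, e z <= (1 - a) * e u + a * e v + a * (1 - a) * (k / 2 * D u v)
    & D u z <= a ^+ 2 * D u v].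
Proof.
move=> du dv; have [Dw uvDw H] := gen_geod du du dv.
have DwE : Dw = D u v.
  apply/le_anti; rewrite uvDw andbT; apply: le_of_shrink_le => a /andP[a0 a1].
  have a01 : 0 <= a <= 1 by rewrite (ltW a0).
  have [z [_ _]] := H a a01; rewrite D_diag => Dz; have := D_ge0 u z.
  by move=> Dz0; rewrite -(ler_pM2l a0); lra.
move=> a a01; have [z [dz ez Dz]] := H a a01; exists z; split=> //.
  apply: le_trans ez _; rewrite DwE lerD2l.
  have -> : - (a * (1 - a) * lam / 2 * D u v) = a * (1 - a) * (- lam / 2 * D u v).
    by ring.
  case/andP: a01 => a0 a1; apply: ler_wpM2l; first by rewrite mulr_ge0// subr_ge0.
  by apply: ler_wpM2r => //; have := lam_minus_geN; lra.
by apply: le_trans Dz _; rewrite D_diag DwE; lra.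
Qed.

(** Along a geodesic from [u] to [v] the energy drop is at least [a] times the full drop, up to the
    convexity defect; testing the local bound at a small [a] and dividing by [a] gives the global
    one. *)
Lemma slope_le_local u S : 0 <= S -> Dom u ->
  (forall eps, 0 < eps -> exists2 r, 0 < r & forall z, Dom z -> dist u z < r ->
     e u - e z <= (S + eps) * dist u z) ->
  slope_le u S.
Proof.
move=> S0 du loc; split=> // v dv; have := dist_sq u v.
have := sqrtr_ge0 (D u v); set w := dist u v => w0 ww.
suff H eps : 0 < eps -> e u - e v <= (S + eps) * w + k / 2 * D u v.
  apply/ler_addgt0Pr => eps eps0.
  have w1 : 0 < w + 1 by lra.
  have := H (eps / (w + 1)); rewrite divr_gt0// => /(_ isT) /le_trans; apply.
  have : eps / (w + 1) * w <= eps.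
    by rewrite mulrAC ler_pdivrMr// ler_wpM2l ?(ltW eps0)//; lra.
  by lra.
move=> eps0; have [r r0 Hr] := loc _ eps0.
have wr : 0 < w + r by lra.
(* Chosen so that [0 < a <= 1] and [a * w < r], including the case [w = 0]. *)
pose a := r / (w + r).
have a0 : 0 < a by rewrite divr_gt0.
have a1 : a <= 1 by rewrite ler_pdivrMr//; lra.
have aw : a * w < r by rewrite /a mulrAC ltr_pdivrMr// ltr_pM2l//; lra.
have a01 : 0 <= a <= 1 by rewrite (ltW a0).
have [z [dz ez Dz]] := geod_from_base du dv a01.
have uz : dist u z <= a * w.
  rewrite -ler_sqr ?nnegrE ?sqrtr_ge0 ?(mulr_ge0 (ltW a0) w0)//.
  by rewrite dist_sq exprMn ww.
have := Hr _ dz (le_lt_trans uz aw).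
have : (S + eps) * dist u z <= (S + eps) * (a * w) by apply: ler_wpM2l => //; lra.
have kD : 0 <= k / 2 * D u v by rewrite mulr_ge0 ?divr_ge0 ?lam_minus_ge0.
have := mulr_ge0 (ltW a0) (mulr_ge0 (ltW a0) kD).
by move=> H1 H2 H3; rewrite -(ler_pM2l a0); lra.
Qed.

Hypothesis lower_bound : exists p c C,
  [/\ Dom p, 0 <= c & forall v, Dom v -> - C - c * D p v <= e v].

(** The constant [c] may exceed [(2 * t)^-1]. Testing the bound at an interpolant near [u] costs
    [c * a ^+ 2 * D u v]; convexity transfers it to [v] after division by [a], so only
    [c * a * D u v] is lost. *)
Lemma prox_lower_bound t u : 0 < t -> k * t < 1 -> Dom u ->
  exists C, forall v, Dom v -> C <= (2 * t)^-1 * D u v + e v.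
Proof.
move=> t0 kt du; have [p [c [C [dp c0 lb]]]] := lower_bound.
pose C' := C + 2 * c * D p u; pose c' := 2 * c.
have {}lb v : Dom v -> - C' - c' * D u v <= e v.
  move=> dv; apply: le_trans (lb _ dv); rewrite /C' /c'.
  have : c * D p v <= c * (2 * D p u + 2 * D u v).
    apply: ler_wpM2l => //; apply: le_trans (dist_triangle dp du dv) _.
    have := dist_sq p u; have := dist_sq u v.
    have := sqr_ge0 (dist p u - dist u v); lra.
  by lra.
have c'0 : 0 <= c' by rewrite mulr_ge0.
(* The room left once the convexity defect [k / 2] is paid; [a] below is chosen so that
   [c' * a <= dl]. *)
pose dl := (2 * t)^-1 - k / 2.
have dl0 : 0 < dl.
  rewrite /dl subr_gt0 -[ltRHS]mul1r ltr_pdivlMr ?mulr_gt0//; lra.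
have cd : 0 < c' + dl by lra.
pose a := dl / (c' + dl).
have a0 : 0 < a by rewrite divr_gt0.
have a1 : a <= 1 by rewrite ler_pdivrMr//; lra.
have ca : c' * a <= dl by rewrite /a mulrA ler_pdivrMr// mulrC ler_wpM2l ?(ltW dl0)//; lra.
have a01 : 0 <= a <= 1 by rewrite (ltW a0).
exists ((- C' - (1 - a) * e u) / a) => v dv.
have [z [dz ez Dz]] := geod_from_base du dv a01.
have ez' := lb _ dz; have Dz' := ler_wpM2l c'0 Dz.
have ca' : a * (D u v * (c' * a)) <= a * (D u v * dl).
  by apply: ler_wpM2l; [exact: ltW|exact: ler_wpM2l].
have kD : 0 <= k / 2 * D u v by rewrite mulr_ge0 ?divr_ge0 ?lam_minus_ge0.
have ka := mulr_ge0 (ltW a0) (mulr_ge0 (ltW a0) kD).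
rewrite ler_pdivrMr//; rewrite /dl in ca'; lra.
Qed.

(** The rate is that of [W2sq_complete], where powers of 4 are spent on the way. The energy bound
    places the limit in [Dom]. *)
Hypothesis complete_lsc : forall v : nat -> M, (forall j, Dom (v j)) ->
  (forall j, D (v j) (v j.+1) <= 16 ^- j) ->
  (exists B, forall j, e (v j) <= B) ->
  exists z, [/\ Dom z,
    forall eps, 0 < eps -> exists N, forall j, (N <= j)%N -> dist (v j) z <= eps
    & forall c, (exists N, forall j, (N <= j)%N -> e (v j) <= c) -> e z <= c].

Lemma exists_geometric_le (eps : R) : 0 < eps ->
  exists N, forall j, (N <= j)%N -> 16 ^- j <= eps.
Proof.
move=> eps0; exists (Num.truncn eps^-1) => j Nj.
rewrite -[leRHS]invrK lef_pV2 ?posrE ?invr_gt0 ?exprn_gt0//.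
have : eps^-1 <= j.+1%:R.
  have /ltW/le_trans := truncnS_gt eps^-1; apply; by rewrite ler_nat.
move=> /le_trans; apply; rewrite -natrX ler_nat.
by apply: ltn_expl.
Qed.

Lemma prox_exists t u : 0 < t -> k * t < 1 -> Dom u -> exists z, is_prox t u z.
Proof.
move=> t0 kt du; have [C lb] := prox_lower_bound t0 kt du.
pose Phi v := (2 * t)^-1 * D u v + e v.
pose S := [set y | exists2 v, Dom v & y = Phi v].
have hS : has_inf S.
  by split; [exists (Phi u); exists u|exists C => _ [v dv ->]; exact: lb].
pose I := inf S.
have Ile v : Dom v -> I <= Phi v by move=> dv; apply: ge_inf => //; [exact: hS.2|exists v].
(* At the midpoint [a * (1 - a) = 1 / 4], so [Phi] falls below the mean of its end values by at
   least [eta * Dw]. As [Phi] stays above [I], gaps [eta * 16 ^- j] give squared steps [16 ^- j]. *)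
pose eta := (t^-1 - k) / 8.
have eta0 : 0 < eta.
  by rewrite divr_gt0// subr_gt0 -[ltRHS]mul1r ltr_pdivlMr.
have vP j : exists v, Dom v /\ Phi v < I + eta * 16 ^- j.
  have e0 : 0 < eta * 16 ^- j by rewrite mulr_gt0// invr_gt0 exprn_gt0.
  by have [_ [v dv ->] ?] := inf_adherent e0 hS; exists v.
have [v vH] := choice vP.
have e0 j : 0 < 16 ^- j :> R by rewrite invr_gt0 exprn_gt0.
have ele j : 16 ^- j.+1 <= 16 ^- j :> R.
  by rewrite lef_pV2 ?posrE ?exprn_gt0// exprS ler_peMl ?exprn_ge0//; lra.
have vD j : D (v j) (v j.+1) <= 16 ^- j.
  have [[dj vj] [dj1 vj1]] := (vH j, vH j.+1).
  have [Dw vDw H] := gen_geod du dj dj1.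
  have h01 : 0 <= (2^-1 : R) <= 1 by lra.
  have [z [dz ez Dz]] := H _ h01; have Iz := Ile _ dz.
  have t20 : 0 < (2 * t)^-1 by rewrite invr_gt0 mulr_gt0.
  have Dz' := ler_wpM2l (ltW t20) Dz.
  have Dw0 : 0 <= Dw := le_trans (D_ge0 _ _) vDw.
  have lamDw : - lam * Dw <= k * Dw by apply: ler_wpM2r => //; exact: lam_minus_geN.
  have tE : t^-1 = 2 * (2 * t)^-1 by rewrite invfM mulrA divff ?mul1r.
  have etaj : eta * 16 ^- j.+1 <= eta * 16 ^- j by apply: ler_wpM2l => //; exact: ltW.
  apply: le_trans vDw _; rewrite -(ler_pM2l eta0).
  have etaDw : eta * Dw = (2 * (2 * t)^-1 - k) / 8 * Dw by rewrite /eta tE.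
  rewrite etaDw; move: vj vj1 Iz etaj Dz' ez lamDw; rewrite /Phi.
  move: (eta / _) (eta / _) ((2 * t)^-1) => p q i; lra.
have [B0|] := pselect (exists B, forall j, e (v j) <= B); last first.
  case; exists (I + eta) => j; have [dj vj] := vH j.
  have : 0 <= (2 * t)^-1 * D u (v j) by rewrite mulr_ge0// invr_ge0 mulr_ge0// ltW.
  have : eta * 16 ^- j <= eta * 1.
    apply: ler_wpM2l; first exact: ltW.
    by rewrite -[leRHS]invr1 lef_pV2 ?posrE ?exprn_gt0// exprn_ege1//; lra.
  by move: vj; rewrite /Phi; lra.
have [z [dz vz lsc]] := complete_lsc (fun j => (vH j).1) vD B0.
exists z; split=> // y dy; apply: le_trans (Ile _ dy).
apply/ler_addgt0Pr => eps eps0; rewrite -lerBrDl.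
apply: lsc.
have t20 : 0 < (2 * t)^-1 by rewrite invr_gt0 mulr_gt0.
have eps2 : 0 < eps / 2 / eta by apply: divr_gt0 => //; apply: divr_gt0.
have [N1 HN1] := exists_geometric_le eps2.
pose w := dist u z; have w0 : 0 <= w := sqrtr_ge0 _.
(* Half of [eps] pays for the gap to the infimum, half for replacing [D u (v j)] by [D u z], an
   error of at most [2 * w * ep]; the 1 keeps the denominator positive. *)
pose ep := eps / 2 / ((2 * t)^-1 * (2 * w + 1)).
have den0 : 0 < (2 * t)^-1 * (2 * w + 1) by rewrite mulr_gt0//; lra.
have ep0 : 0 < ep by apply: divr_gt0 => //; apply: divr_gt0.
have [N2 HN2] := vz _ ep0.
exists (maxn N1 N2) => j; rewrite geq_max => /andP[/HN1 j1 /HN2 j2].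
have [dj vj] := vH j.
have tri := dist_triangle du dj dz.
have Dj : D u z - 2 * w * ep <= D u (v j).
  rewrite -(dist_sq u z) -/w -(dist_sq u (v j)).
  rewrite -(dist_sq u z) -/w in tri.
  have := sqrtr_ge0 (D u (v j)); have := sqrtr_ge0 (D (v j) z).
  move: (dist u (v j)) (dist (v j) z) tri j2 => a b tri bep b0 a0.
  have wab : w <= a + b by rewrite -ler_sqr ?nnegrE ?addr_ge0.
  have wb : w * b <= w * ep by apply: ler_wpM2l.
  have [wb'|wb'] := leP w b.
    have : w * w <= w * b by apply: ler_wpM2l.
    by have := sqr_ge0 w; have := sqr_ge0 a; lra.
  have : (w - b) ^+ 2 <= a ^+ 2 by rewrite ler_sqr ?nnegrE//; lra.
  by have := sqr_ge0 b; lra.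
have Dj' := ler_wpM2l (ltW t20) Dj.
have epE : ep * ((2 * t)^-1 * (2 * w + 1)) = eps / 2 by rewrite /ep divfK// gt_eqF.
have etaE : eta * (eps / 2 / eta) = eps / 2 by rewrite mulrC divfK// gt_eqF.
have j1' := ler_wpM2l (ltW eta0) j1; rewrite etaE in j1'.
have : 0 <= (2 * t)^-1 * ep by rewrite mulr_ge0// ltW.
by move: vj; rewrite /Phi; lra.
Qed.

End proximal_scheme.

(** * Gluing two probabilities along countable partitions *)

Section nat_partition.
Local Open Scope ereal_scope.
Context {R : realType}.

Lemma probability_of_subprobability d (S : measurableType d)
    (m : subprobability S R) : m setT = 1 ->
  exists P : probability S R, forall A, P A = m A.
Proof.
move=> m1; exists (mnormalize m (point : probability S R)) => A.
have m1' : (m : {measure set S -> \bar R}) setT = 1 by exact: m1.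
by rewrite /= /mnormalize m1' onee_eq0 /= invr1 mule1.
Qed.

Lemma probability_push d d' (S : measurableType d) (S' : measurableType d')
    (P : probability S R) (f : S -> S') : measurable_fun setT f ->
  exists Q : probability S' R, forall A, Q A = P (f @^-1` A).
Proof.
move=> mf; pose F : {mfun S >-> S'} := HB.pack f (isMeasurableFun.Build _ _ _ _ _ mf).
by exists (distribution P F).
Qed.

Lemma is_push_integral d d' (S : measurableType d) (S' : measurableType d')
    (P : probability S R) (Q : probability S' R) (f : S -> S') (h : S' -> \bar R) :
  measurable_fun setT f -> is_push measurable P f measurable Q ->
  measurable_fun setT h -> (forall y, 0 <= h y) ->
  \int[Q]_y h y = \int[P]_x h (f x).
Proof.
move=> mf PQ mh h0.
rewrite (eq_measure_integral (pushforward P f)); last by move=> A mA _; exact: PQ.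
by rewrite ge0_integral_pushforward//= preimage_setT.
Qed.

Lemma measurable_preimage1 d (S : measurableType d) (f : S -> nat) k :
  measurable_fun setT f -> measurable (f @^-1` [set k]).
Proof. by move=> mf; rewrite -[X in measurable X]setTI; exact: mf. Qed.

Lemma bigcup_preimage1 (S : Type) (f : S -> nat) : \bigcup_k (f @^-1` [set k]) = setT.
Proof. by apply/seteqP; split=> // x _; exists (f x). Qed.

Lemma measure_nat_partition d (S : measurableType d) (P : probability S R)
    (f : S -> nat) (B : set S) : measurable_fun setT f -> measurable B ->
  P B = \sum_(k <oo) P (B `&` f @^-1` [set k]).
Proof.
move=> mf mB; rewrite -[in LHS](setIT B) -(bigcup_preimage1 f) setI_bigcupr.
rewrite measure_semi_bigcup//=.
- by move=> k; apply: measurableI => //; exact: measurable_preimage1.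
- by apply: trivIset_setIl; exact: trivIset_preimage1.
- by apply: bigcup_measurable => k _; apply: measurableI => //; exact: measurable_preimage1.
Qed.

Lemma integral_nat_valued d (S : measurableType d) (P : probability S R)
    (f : S -> nat) (phi : nat -> \bar R) : measurable_fun setT f ->
  (forall k, 0 <= phi k) ->
  \int[P]_x phi (f x) = \sum_(k <oo) phi k * P (f @^-1` [set k]).
Proof.
move=> mf phi0; rewrite -(bigcup_preimage1 f) ge0_integral_bigcup//=.
- apply: eq_eseriesr => k _; rewrite (eq_integral (cst (phi k))).
    by rewrite integral_cst//; exact: measurable_preimage1.
  by move=> x /[!inE] /= <-.
- by move=> k; exact: measurable_preimage1.
- by rewrite bigcup_preimage1; apply: (@measurableT_comp _ _ _ _ _ _ phi).
- exact: trivIset_preimage1.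
Qed.

(** Restrict to each cell and normalize. On a null cell both sides vanish, whatever default
    [mnormalize] uses. *)
Lemma conditioning_nat d (S : measurableType d) (P : probability S R)
    (f : S -> nat) : measurable_fun setT f ->
  exists K : nat -> probability S R, forall k B, measurable B ->
    P (f @^-1` [set k]) * K k B = P (B `&` f @^-1` [set k]).
Proof.
move=> mf; have mQ k : measurable (f @^-1` [set k]) by exact: measurable_preimage1.
exists (fun k => mnormalize (mrestr P (mQ k)) P) => k B mB.
rewrite /= /mnormalize /= /mrestr /= setTI.
have Pfin : P (f @^-1` [set k]) \is a fin_num by exact: fin_num_measure.
have [P0|PN0] := eqVneq (P (f @^-1` [set k])) 0.
  rewrite /= P0 mul0e; apply/esym/eqP; rewrite -measure_le0 -P0.
  by apply: le_measure; rewrite ?inE//; exact: measurableI.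
have -> /= : (P (f @^-1` [set k]) == +oo) = false.
  by apply/negbTE; move: Pfin; rewrite fin_numE => /andP[].
rewrite muleCA -[X in _ * (X * _)](fineK Pfin) -EFinM divff ?mule1//.
by rewrite fine_eq0.
Qed.

(** Draw [z] from [P1], then draw the second point from [P2] conditioned on the cell with label
    [f1 z]. Equality of the cell masses makes the second marginal [P2]. *)
Lemma nat_gluing d1 d2 (S1 : measurableType d1) (S2 : measurableType d2)
    (P1 : probability S1 R) (P2 : probability S2 R)
    (f1 : S1 -> nat) (f2 : S2 -> nat) :
  measurable_fun setT f1 -> measurable_fun setT f2 ->
  (forall k, P1 (f1 @^-1` [set k]) = P2 (f2 @^-1` [set k])) ->
  exists G : probability (S1 * S2)%type R,
    [/\ is_push measurable G fst measurable P1, is_push measurable G snd measurable P2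
      & {ae G, forall z, f1 z.1 = f2 z.2}].
Proof.
move=> mf1 mf2 P12; have [K KE] := conditioning_nat P2 mf2.
pose F (z : S1) : giry (S1 * S2)%type R := giry_prod (giry_ret z, K (f1 z) : giry S2 R).
have mF : measurable_fun setT F.
  apply: (measurableT_comp (f := giry_prod)); first exact: measurable_giry_prod.
  apply: measurable_fun_pair; first exact: measurable_giry_ret.
  exact: (@measurableT_comp _ _ _ _ _ _ (fun k => K k : giry S2 R)).
pose G0 := giry_bind (P1 : giry S1 R) mF.
have G0E C : measurable C -> G0 C = \int[P1]_z F z C.
  by move=> mC; rewrite /G0 /giry_bind /= giry_int_map//; exact: measurable_giry_ev.
have G0X A B : measurable A -> measurable B ->
    G0 (A `*` B) = \int[P1]_(z in A) K (f1 z) B.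
  move=> mA mB; rewrite G0E; last exact: measurableX.
  rewrite [RHS]integral_mkcond; apply: eq_integral => z _.
  rewrite /F /giry_prod /= product_measure1E//= diracE patchE.
  by case: ifPn => _; rewrite ?mul1e ?mul0e.
have G01 : G0 setT = 1.
  rewrite -setXTT G0X// (eq_integral (cst 1)); last first.
    by move=> z _; rewrite /= probability_setT.
  by rewrite integral_cst//= mul1e probability_setT.
have [G GE] := probability_of_subprobability G01.
exists G; split.
- move=> A mA; rewrite GE; have -> : fst @^-1` A = A `*` [set: S2].
    by apply/seteqP; split=> -[x y] /=; [|case].
  rewrite G0X// (eq_integral (cst 1)).
    by rewrite integral_cst// mul1e.
  by move=> z _; rewrite /= probability_setT.
- move=> B mB; rewrite GE; have -> : snd @^-1` B = [set: S1] `*` B.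
    by apply/seteqP; split=> -[x y] /=; [|case].
  rewrite G0X// (integral_nat_valued _ (phi := fun k => K k B))//.
  rewrite (measure_nat_partition P2 mf2)//; apply: eq_eseriesr => k _.
  by rewrite -KE// muleC -P12.
- exists (\bigcup_k (f1 @^-1` [set k] `*` ~` (f2 @^-1` [set k]))).
  have mC k : measurable (f1 @^-1` [set k] `*` ~` (f2 @^-1` [set k])).
    by apply: measurableX; [|apply: measurableC]; exact: measurable_preimage1.
  split; first by apply: bigcup_measurable.
    have null k : G (f1 @^-1` [set k] `*` ~` (f2 @^-1` [set k])) = 0.
      rewrite GE G0X; [|exact: measurable_preimage1
                       |by apply: measurableC; exact: measurable_preimage1].
      rewrite (eq_integral (cst (K k (~` (f2 @^-1` [set k]))))); last first.
        by move=> z /[!inE] /= ->.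
      rewrite integral_cst//; last exact: measurable_preimage1.
      have := KE k _ (measurableC (measurable_preimage1 k mf2)).
      by rewrite setICl measure0 -P12 muleC.
    apply/eqP; rewrite -measure_le0; apply: le_trans (measure_sigma_subadditive _ _ _ _) _.
    + exact: mC.
    + exact: bigcup_measurable.
    + exact: subset_refl.
    + by rewrite eseries0// => k _ _; exact: null.
  move=> [x y] /= xy; exists (f1 x) => //; split=> //= e; exact: xy.
Qed.

End nat_partition.

(** * Borel structure and small cells of Euclidean space *)

Section euclidean_borel.
Context {R : realType} {d : nat}.
Local Notation T := (Rd R d).

Lemma measurable_natP dS (S : measurableType dS) (f : S -> nat) :
  (forall k, measurable (f @^-1` [set k])) -> measurable_fun setT f.
Proof.
move=> mf _ A _; rewrite setTI (_ : _ @^-1` _ = \bigcup_(k in A) (f @^-1` [set k])).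
  by apply: bigcup_measurable => k _.
by apply/seteqP; split=> [x Ax|x [k Ak /= ->]//]; exists (f x).
Qed.

Lemma measurable_coord (i : 'I_d) : measurable_fun setT (fun x : T => x ord0 i).
Proof.
apply: (measurability _ (RGenOpens.measurableE R)).
move=> _ [_ [a [b ->] <-]]; rewrite setTI; apply: sub_sigma_algebra.
apply: (@open_comp 'rV[R]_d R (fun x : 'rV[R]_d => x ord0 i)); last exact: interval_open.
by move=> x _; exact: coord_continuous.
Qed.

(** An open set is the union of the rational boxes it contains, a countable family; the preimage of
    a box is a finite intersection of coordinate preimages. *)
Lemma measurable_Rd dS (S : measurableType dS) (f : S -> T) :
  (forall i, measurable_fun setT (fun s => f s ord0 i)) -> measurable_fun setT f.
Proof.
move=> mf; apply: (@measurability _ _ S T setT f (@open 'rV[R]_d)) => //.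
move=> _ [U oU <-]; rewrite setTI.
pose box (c : 'rV[rat]_d * nat) : set 'rV[R]_d :=
  [set x | forall i, `|x ord0 i - ratr (c.1 ord0 i)| < c.2.+1%:R^-1].
pose idx := [set c | box c `<=` U].
have -> : f @^-1` U = \bigcup_(c in idx) \bigcap_i
    ((fun s => f s ord0 i) @^-1` (ball (ratr (c.1 ord0 i) : R) c.2.+1%:R^-1)).
  apply/seteqP; split=> [s /= Us|s [c cU cs]]; last first.
    apply: cU => i; have := cs i I; rewrite /= /ball /= distrC; exact.
  move: (oU); rewrite openE => /(_ _ Us) /nbhs_ballP[e /= e0 eU].
  have [n ne] : exists n, n.+1%:R^-1 < e / 2.
    have [n _ /(_ n (leqnn n))] := near_infty_natSinv_lt (PosNum (divr_gt0 e0 (ltr0n R 2))).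
    by exists n.
  have n0 : 0 < n.+1%:R^-1 :> R by rewrite invr_gt0.
  have qP i : exists q : rat, `|f s ord0 i - ratr q| < n.+1%:R^-1.
    move: (f s ord0 i) (n.+1%:R^-1 : R) n0 => a r r0.
    have [|q] := @rat_in_itvoo R (a - r) (a + r); first by lra.
    by rewrite in_itv /= => /andP[q1 q2]; exists q; rewrite ltr_norml; apply/andP; split; lra.
  have [q qs] := choice qP.
  exists (\row_i q i, n); last by move=> i _ /=; rewrite /ball /= distrC mxE.
  move=> x xq; apply: eU; split=> // i j; rewrite (ord1 i).
  have := xq j; have := qs j; rewrite /= mxE => h1 h2.
  rewrite /ball /=; have -> : f s ord0 j - x ord0 j =
    (f s ord0 j - ratr (q j)) - (x ord0 j - ratr (q j)) by ring.
  apply: le_lt_trans (ler_normB _ _) _; rewrite [ltRHS](splitr e).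
  by apply: ltrD; [exact: lt_trans h1 ne|exact: lt_trans h2 ne].
rewrite bigcup_mkcond; apply: countable_bigcupT_measurable => [|c]; first exact: countableP.
case: ifPn => // _; apply: fin_bigcap_measurable => // i _.
rewrite -[X in measurable X]setTI; apply: mf => //.
by apply: open_measurable; apply: ball_open; rewrite invr_gt0.
Qed.

Lemma measurable_sqdist dS (S : measurableType dS) (f g : S -> T) :
  measurable_fun setT f -> measurable_fun setT g ->
  measurable_fun setT (fun s => sqdist (f s) (g s)).
Proof.
move=> mf mg; apply: measurable_sum => i; apply: measurable_funX.
apply: measurable_funB.
  exact: (measurableT_comp (measurable_coord i) mf).
exact: (measurableT_comp (measurable_coord i) mg).
Qed.

Lemma sqdist_ge0 (x y : T) : 0 <= sqdist x y.
Proof. by apply: sumr_ge0 => i _; exact: sqr_ge0. Qed.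

Lemma sqdistC (x y : T) : sqdist x y = sqdist y x.
Proof. by apply: eq_bigr => i _; rewrite -sqrrN opprB. Qed.

Lemma sqdist_triangle3 (x y z t : T) :
  sqdist x t <= 3 * (sqdist x y + sqdist y z + sqdist z t).
Proof.
rewrite /sqdist -!big_split/= mulr_sumr; apply: ler_sum => i _.
move: (x ord0 i) (y ord0 i) (z ord0 i) (t ord0 i) => a b c e.
have := sqr_ge0 ((a - b) - (b - c)); have := sqr_ge0 ((b - c) - (c - e)).
have := sqr_ge0 ((a - b) - (c - e)); lra.
Qed.

Lemma exists_cells (delta : R) : 0 < delta -> exists2 q : T -> nat,
  measurable_fun setT q & forall x y, q x = q y -> sqdist x y <= delta.
Proof.
(* A grid of side [s] has cells of squared diameter at most [d * s ^+ 2]; dividing by [d.+1] covers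
   [d = 0]. The integer vector of a cell is coded by [pickle]. *)
move=> delta0; pose s := Num.sqrt (delta / d.+1%:R).
have s0 : 0 < s by rewrite sqrtr_gt0 divr_gt0.
pose fl (x : T) := [ffun i : 'I_d => Num.floor (x ord0 i / s)].
exists (fun x => choice.pickle (fl x)).
  apply: measurable_natP => k.
  have [[x0 <-]|none] := pselect (exists x0, choice.pickle (fl x0) = k); last first.
    rewrite (_ : _ @^-1` _ = set0)//; apply/seteqP; split=> // x /= xk.
    by apply: none; exists x.
  rewrite (_ : _ @^-1` _ = \bigcap_i ((fun x : T => x ord0 i / s) @^-1`
     `[(fl x0 i)%:~R, (fl x0 i + 1)%:~R[)).
    apply: fin_bigcap_measurable => // i _; rewrite -[X in measurable X]setTI.
    apply: (measurable_funM (measurable_coord i)) => //.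
  apply/seteqP; split=> x /=.
    move=> /(pcan_inj choice.pickleK) xx0 i _ /=; rewrite in_itv/= -floor_eq -xx0.
    by rewrite ffunE.
  move=> H; congr choice.pickle; apply/ffunP => i; have := H i I.
  by rewrite /= in_itv/= -floor_eq [in RHS]ffunE /fl !ffunE => /eqP.
move=> x y /(pcan_inj choice.pickleK) xy.
have le1 i : (x ord0 i - y ord0 i) ^+ 2 <= delta / d.+1%:R.
  have := congr1 (fun f : {ffun 'I_d -> int} => f i) xy; rewrite !ffunE => fxy.
  have /andP[x1 x2] := floor_itv (x ord0 i / s).
  have /andP[y1 y2] := floor_itv (y ord0 i / s).
  rewrite fxy in x1 x2; rewrite intrD in x2 y2.
  rewrite -(@sqr_sqrtr _ (delta / _)) -/s; last by rewrite divr_ge0 ?(ltW delta0).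
  rewrite -(real_normK (num_real (_ - _))) ler_sqr ?nnegrE ?(ltW s0)//.
  have -> : x ord0 i - y ord0 i = (x ord0 i / s - y ord0 i / s) * s.
    by field; rewrite gt_eqF.
  rewrite normrM (gtr0_norm s0) ler_piMl ?(ltW s0)// ler_norml.
  by apply/andP; split; lra.
apply: le_trans (_ : \sum_(i < d) (delta / d.+1%:R) <= _).
  by apply: ler_sum => i _; exact: le1.
rewrite sumr_const card_ord -[_ *+ d]mulr_natr -mulrA ler_piMr ?(ltW delta0)//.
by rewrite mulrC ler_pdivrMr// mul1r ler_nat.
Qed.

End euclidean_borel.

(** * Couplings, a rough triangle inequality, and interpolation *)

Section wasserstein.
Local Open Scope ereal_scope.
Context {R : realType} {d : nat}.
Local Notation T := (Rd R d).
Local Notation prob X := (probability X R).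
Implicit Types mu nu om : prob T.

Lemma couplingP (g : prob (T * T)%type) mu nu : coupling g mu nu <->
  is_push measurable g fst measurable mu /\ is_push measurable g snd measurable nu.
Proof.
have fstE (A : set T) : fst @^-1` A = A `*` [set: T].
  by apply/seteqP; split=> -[x y] /=; [|case].
have sndE (A : set T) : snd @^-1` A = [set: T] `*` A.
  by apply/seteqP; split=> -[x y] /=; [|case].
split=> [gmn|[gm gn] A mA]; last by rewrite gm ?gn ?fstE ?sndE.
by split=> A mA; have [gm gn] := gmn A mA; rewrite ?fstE ?sndE.
Qed.

Lemma is_push_comp dX dY dZ (X : measurableType dX) (Y : measurableType dY)
    (Z : measurableType dZ) (P : prob X) (Q : prob Y) (L : prob Z)
    (f : X -> Y) (g : Y -> Z) : measurable_fun setT g ->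
  is_push measurable P f measurable Q -> is_push measurable Q g measurable L ->
  is_push measurable P (g \o f) measurable L.
Proof.
move=> mg PQ QL A mA; rewrite QL// PQ//.
by rewrite -[X in measurable X]setTI; exact: mg.
Qed.

Lemma W2sq_le_push dS (S : measurableType dS) (P : prob S) (f g : S -> T) mu nu :
  measurable_fun setT f -> measurable_fun setT g ->
  is_push measurable P f measurable mu -> is_push measurable P g measurable nu ->
  W2sq mu nu <= \int[P]_s (sqdist (f s) (g s))%:E.
Proof.
move=> mf mg Pf Pg.
have mfg : measurable_fun setT (fun s => (f s, g s)) by exact: measurable_fun_pair.
have [G GE] := probability_push P mfg.
apply: ereal_inf_lbound; exists G; split.
  by apply/couplingP; split=> A mA; rewrite GE; [exact: Pf|exact: Pg].
rewrite /cost (@is_push_integral R _ _ _ _ P G (fun s => (f s, g s)))//.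
  by apply/measurable_EFinP; apply: measurable_sqdist.
by move=> y; rewrite lee_fin sqdist_ge0.
Qed.

Lemma cost_ge0 (g : prob (T * T)%type) : 0 <= cost g.
Proof. by apply: integral_ge0 => z _; rewrite lee_fin sqdist_ge0. Qed.

Lemma W2sq_ge0 mu nu : 0 <= W2sq mu nu.
Proof. by apply: le_ereal_inf_tmp => _ [g [_ ->]]; exact: cost_ge0. Qed.

Lemma W2sq_sym mu nu : W2sq mu nu = W2sq nu mu.
Proof.
suff H (m1 m2 : prob T) : W2sq m1 m2 <= W2sq m2 m1 by apply/le_anti; rewrite !H.
apply: le_ereal_inf_tmp => _ [g [/couplingP[g1 g2] ->]].
rewrite /cost; under eq_integral do rewrite sqdistC.
exact: W2sq_le_push.
Qed.

Lemma W2sq_diag mu : W2sq mu mu = 0.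
Proof.
apply/le_anti; rewrite W2sq_ge0 andbT.
have : W2sq mu mu <= \int[mu]_x (sqdist x x)%:E by apply: W2sq_le_push.
move=> /le_trans; apply; rewrite (eq_integral (cst 0)) ?integral0// => x _ /=.
by congr (_%:E); apply: big1 => i _; rewrite subrr expr0n.
Qed.

Lemma W2sq_fineK mu nu : W2sq mu nu < +oo -> (fine (W2sq mu nu))%:E = W2sq mu nu.
Proof. by move=> fin; rewrite fineK// ge0_fin_numE ?W2sq_ge0. Qed.

(** The glued couplings have middle points in a common cell of squared diameter at most 1, whence
    the summand 1; the factor 3 is that of [sqdist_triangle3]. *)
Lemma W2sq_le_glued (g12 g23 : prob (T * T)%type) (mu1 mu2 mu3 : prob T) :
  coupling g12 mu1 mu2 -> coupling g23 mu2 mu3 ->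
  W2sq mu1 mu3 <= 3%:E * (cost g12 + 1 + cost g23).
Proof.
move=> /couplingP[g1 g2] /couplingP[g2' g3].
have [q mq qP] := @exists_cells R d 1%R ltr01.
have mq1 : measurable_fun setT (q \o snd : T * T -> nat) by exact: measurableT_comp.
have mq2 : measurable_fun setT (q \o fst : T * T -> nat) by exact: measurableT_comp.
have [|G [G1 G2 Gq]] := @nat_gluing R _ _ _ _ g12 g23 _ _ mq1 mq2.
  move=> k; have mk : measurable (q @^-1` [set k]) by exact: measurable_preimage1.
  exact: etrans (esym (g2 _ mk)) (g2' _ mk).
have mp1 : measurable_fun setT (fun z : (T * T) * (T * T) => z.1.1) by exact: measurableT_comp.
have mp2 : measurable_fun setT (fun z : (T * T) * (T * T) => z.1.2) by exact: measurableT_comp.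
have mp3 : measurable_fun setT (fun z : (T * T) * (T * T) => z.2.1) by exact: measurableT_comp.
have mp4 : measurable_fun setT (fun z : (T * T) * (T * T) => z.2.2) by exact: measurableT_comp.
have : W2sq mu1 mu3 <= \int[G]_z (sqdist z.1.1 z.2.2)%:E.
  apply: W2sq_le_push => //; [exact: is_push_comp G1 g1|exact: is_push_comp G2 g3].
move=> /le_trans; apply.
have m12 : measurable_fun setT (fun z : (T * T) * (T * T) => (sqdist z.1.1 z.1.2)%:E).
  by apply/measurable_EFinP; exact: measurable_sqdist.
have m34 : measurable_fun setT (fun z : (T * T) * (T * T) => (sqdist z.2.1 z.2.2)%:E).
  by apply/measurable_EFinP; exact: measurable_sqdist.
have -> : cost g12 = \int[G]_z (sqdist z.1.1 z.1.2)%:E.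
  apply: (@is_push_integral R _ _ _ _ G g12 fst) => //.
    by apply/measurable_EFinP; exact: measurable_sqdist.
  by move=> z; rewrite lee_fin sqdist_ge0.
have -> : cost g23 = \int[G]_z (sqdist z.2.1 z.2.2)%:E.
  apply: (@is_push_integral R _ _ _ _ G g23 snd) => //.
    by apply/measurable_EFinP; exact: measurable_sqdist.
  by move=> z; rewrite lee_fin sqdist_ge0.
have -> : 1 = \int[G]_z cst 1 z by rewrite integral_cst//= mul1e probability_setT.
rewrite -ge0_integralD//=; last by move=> z _; rewrite lee_fin sqdist_ge0.
rewrite -ge0_integralD//=; last 3 first.
- by move=> z _; rewrite adde_ge0// lee_fin sqdist_ge0.
- by apply: emeasurable_funD.
- by move=> z _; rewrite lee_fin sqdist_ge0.
rewrite -ge0_integralZl//=; last 2 first.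
- by do 2 apply: emeasurable_funD => //.
- by move=> z _; rewrite !adde_ge0// lee_fin sqdist_ge0.
apply: ae_ge0_le_integral => //=.
- by move=> z _; rewrite lee_fin sqdist_ge0.
- by apply/measurable_EFinP; exact: measurable_sqdist.
- by move=> z _; rewrite mule_ge0// !adde_ge0// lee_fin sqdist_ge0.
- by apply: measurable_funeM; do 2 apply: emeasurable_funD => //.
apply: filterS Gq => z /= /qP zz _.
rewrite -!EFinD -EFinM lee_fin; apply: le_trans (sqdist_triangle3 z.1.1 z.1.2 z.2.1 z.2.2) _.
by rewrite ler_pM2l// lerD2r lerD2l.
Qed.

(** Each coupling is optimal up to 1, and the cell adds another 1. *)
Lemma W2sq_quasi_triangle (mu1 mu2 mu3 : prob T) :
  W2sq mu1 mu2 < +oo -> W2sq mu2 mu3 < +oo ->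
  W2sq mu1 mu3 <= 3%:E * (W2sq mu1 mu2 + W2sq mu2 mu3 + 3%:E).
Proof.
move=> f12 f23.
have near (m m' : prob T) : W2sq m m' < +oo -> exists2 g, coupling g m m' & cost g <= W2sq m m' + 1.
  move=> fin; have fn : W2sq m m' \is a fin_num by rewrite ge0_fin_numE ?W2sq_ge0.
  by have [_ [g [cg ->]] /ltW le1] := lb_ereal_inf_adherent ltr01 fn; exists g.
have [g12 c12 l12] := near _ _ f12; have [g23 c23 l23] := near _ _ f23.
apply: le_trans (W2sq_le_glued c12 c23) _; apply: lee_pmul => //.
  by apply: adde_ge0; [apply: adde_ge0 => //|]; exact: cost_ge0.
rewrite -(W2sq_fineK f12) -(W2sq_fineK f23) in l12 l23 *.
have := leeD (leeD l12 (lexx 1)) l23; move=> /le_trans; apply.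
by rewrite -!EFinD lee_fin; lra.
Qed.

Lemma measurable_geod_map (a : R) : measurable_fun setT (@geod_map R d a).
Proof.
apply: measurable_Rd => i.
rewrite (_ : (fun s => _) = fun x : (T * T) * T =>
  ((1 - a) * x.1.2 ord0 i + a * x.2 ord0 i)%R); last first.
  by apply/funext => x; rewrite /geod_map !mxE.
have m2 : measurable_fun setT (fun x : (T * T) * T => x.1.2 ord0 i).
  apply: (measurableT_comp (measurable_coord i)).
  exact: (measurableT_comp measurable_snd measurable_fst).
have m3 : measurable_fun setT (fun x : (T * T) * T => x.2 ord0 i).
  exact: (measurableT_comp (measurable_coord i) measurable_snd).
by apply: measurable_funD; apply: measurable_funM.
Qed.

Lemma sqdist_geod_map (a : R) (x : (T * T) * T) :
  (sqdist x.1.1 (geod_map a x) + a * (1 - a) * sqdist x.1.2 x.2 =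
   (1 - a) * sqdist x.1.1 x.1.2 + a * sqdist x.1.1 x.2)%R.
Proof.
rewrite /sqdist !mulr_sumr -!big_split; apply: eq_bigr => i _ /=.
by rewrite /geod_map !mxE; ring.
Qed.

(** [sqdist_geod_map] integrated against [w]; optimality of the two marginals identifies the
    integrals on the right. The plan cost stays on the left to avoid a subtraction in the extended
    reals. *)
Lemma transport_plan_interpolation (w : prob ((T * T) * T)%type) om mu0 mu1 :
  transport_plan w om mu0 mu1 -> W2sq om mu0 < +oo -> W2sq om mu1 < +oo ->
  [/\ W2plan_sq w < +oo, W2sq mu0 mu1 <= W2plan_sq w
    & forall (a : R) (mua : prob T), (0 <= a <= 1)%R ->
      is_push measurable w (geod_map a) measurable mua ->
      W2sq om mua + (a * (1 - a))%:E * W2plan_sq w <=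
      (1 - a)%:E * W2sq om mu0 + a%:E * W2sq om mu1].
Proof.
move=> [[g12 [[/couplingP[g1 g2] c12] p12]] [g13 [[/couplingP[g1' g3] c13] p13]]] f0 f1.
have m11 : measurable_fun setT (fun x : (T * T) * T => x.1.1).
  exact: (measurableT_comp measurable_fst measurable_fst).
have m12 : measurable_fun setT (fun x : (T * T) * T => x.1.2).
  exact: (measurableT_comp measurable_snd measurable_fst).
have m2 : measurable_fun setT (fun x : (T * T) * T => x.2) by exact: measurable_snd.
have ms12 : measurable_fun setT (fun x : (T * T) * T => (sqdist x.1.1 x.1.2)%:E).
  by apply/measurable_EFinP; exact: measurable_sqdist.
have ms13 : measurable_fun setT (fun x : (T * T) * T => (sqdist x.1.1 x.2)%:E).
  by apply/measurable_EFinP; exact: measurable_sqdist.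
have ms23 : measurable_fun setT (fun x : (T * T) * T => (sqdist x.1.2 x.2)%:E).
  by apply/measurable_EFinP; exact: measurable_sqdist.
have msT : measurable_fun setT (fun z : T * T => (sqdist z.1 z.2)%:E).
  by apply/measurable_EFinP; exact: measurable_sqdist.
have s0 (x y : T) : 0 <= (sqdist x y)%:E by rewrite lee_fin sqdist_ge0.
have i12 : W2sq om mu0 = \int[w]_x (sqdist x.1.1 x.1.2)%:E.
  rewrite -c12 /cost (@is_push_integral R _ _ _ _ w g12 (@pi12 R d))//.
  exact: measurable_fun_pair.
have i13 : W2sq om mu1 = \int[w]_x (sqdist x.1.1 x.2)%:E.
  rewrite -c13 /cost (@is_push_integral R _ _ _ _ w g13 (@pi13 R d))//.
  exact: measurable_fun_pair.
have pw1 : is_push measurable w (fun x : (T * T) * T => x.1.1) measurable om.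
  exact: (is_push_comp measurable_fst p12 g1).
have pw2 : is_push measurable w (fun x : (T * T) * T => x.1.2) measurable mu0.
  exact: (is_push_comp measurable_snd p12 g2).
have pw3 : is_push measurable w (fun x : (T * T) * T => x.2) measurable mu1.
  exact: (is_push_comp measurable_snd p13 g3).
split.
- have : W2plan_sq w <= \int[w]_x (3%:E * ((sqdist x.1.1 x.1.2)%:E + (sqdist x.1.1 x.2)%:E)).
    apply: ge0_le_integral => //=.
    + by apply: measurable_funeM; apply: emeasurable_funD.
    move=> x _; rewrite -EFinD -EFinM lee_fin.
    apply: le_trans (sqdist_triangle3 x.1.2 x.1.1 x.1.1 x.2) _.
    rewrite ler_pM2l// lerD2r sqdistC [X in (_ + X <= _)%R]big1 ?addr0//.
    by move=> i _; rewrite subrr expr0n.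
  move=> /le_lt_trans; apply; rewrite ge0_integralZl//=; last 2 first.
  + exact: emeasurable_funD.
  + by move=> x _; rewrite adde_ge0.
  by rewrite ge0_integralD// -i12 -i13 lte_mul_pinfty// lte_add_pinfty.
- exact: W2sq_le_push.
move=> a mua /andP[a0 a1] wa.
have ma := measurable_geod_map a.
have a01 : (0 <= a * (1 - a))%R by rewrite mulr_ge0// subr_ge0.
have msa : measurable_fun setT (fun x : (T * T) * T => (sqdist x.1.1 (geod_map a x))%:E).
  by apply/measurable_EFinP; exact: measurable_sqdist.
have : W2sq om mua <= \int[w]_x (sqdist x.1.1 (geod_map a x))%:E by exact: W2sq_le_push.
move=> /(leeD2r ((a * (1 - a))%:E * W2plan_sq w)) /le_trans; apply.
rewrite i12 i13 /W2plan_sq -!ge0_integralZl_EFin ?subr_ge0//.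
rewrite -!ge0_integralD//; last first.
all: try (by move=> x _; rewrite mule_ge0// lee_fin ?subr_ge0).
all: try (by apply: measurable_funeM).
under eq_integral do rewrite -EFinM -EFinD sqdist_geod_map.
exact: lexx.
Qed.

End wasserstein.

(** * One step of a countable Markov chain driven by a uniform variable *)

Section nested_intervals.
Context {R : realType}.
Implicit Types (p : nat -> nat -> R) (nu : nat -> R).

Definition row_cdf p nu i j : R := (\sum_(l < j) p i l) / nu i.

(* If the state [(i, u)] has first component of law [nu] and [u] is uniform on
   ]0, 1] given [i], so is the new state, with [j] drawn from the row [p i]. The
   junk value 2 (outside ]0, 1]) marks the null event that no interval fits. *)
Definition chain_step p nu (s : nat * R) : nat * R :=
  let j := xget 0%N [set j | row_cdf p nu s.1 j < s.2 <= row_cdf p nu s.1 j.+1] in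
  (j, if row_cdf p nu s.1 j < s.2 <= row_cdf p nu s.1 j.+1
      then (s.2 - row_cdf p nu s.1 j) / (p s.1 j / nu s.1) else 2).

Definition state_event (S : Type) (s : S -> nat * R) i (a b : R) : set S :=
  [set x | (s x).1 = i /\ a < (s x).2 <= b].

Lemma row_cdfS p nu i j : row_cdf p nu i j.+1 = row_cdf p nu i j + p i j / nu i.
Proof. by rewrite /row_cdf big_ord_recr/= mulrDl. Qed.

Lemma row_cdf_ge0 p nu i j : (forall i j, 0 <= p i j) -> (forall i, 0 <= nu i) ->
  0 <= row_cdf p nu i j.
Proof. by move=> p0 nu0; rewrite divr_ge0// sumr_ge0. Qed.

Lemma row_cdf_mono p nu i j j' : (forall i j, 0 <= p i j) -> (forall i, 0 <= nu i) ->
  (j <= j')%N -> row_cdf p nu i j <= row_cdf p nu i j'.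
Proof.
move=> p0 nu0; elim: j' => [|j' IH]; first by rewrite leqn0 => /eqP ->.
rewrite leq_eqVlt => /predU1P[->//|]; rewrite ltnS => /IH /le_trans; apply.
by rewrite row_cdfS lerDl divr_ge0.
Qed.

(** The new label is [j] when [u] lies in the [j]-th interval, which the step rescales affinely onto
    ]0, 1]. The bound [b <= 1] excludes the junk value, and monotonicity of [row_cdf] makes [j]
    unique. *)
Lemma chain_stepP p nu i u j (a b : R) :
  (forall i j, 0 <= p i j) -> (forall i, 0 <= nu i) -> 0 <= a -> b <= 1 ->
  ((chain_step p nu (i, u)).1 = j /\ a < (chain_step p nu (i, u)).2 <= b) <->
  row_cdf p nu i j + a * (p i j / nu i) < u <= row_cdf p nu i j + b * (p i j / nu i).
Proof.
move=> p0 nu0 a0 b1; rewrite /chain_step /=; set A := [set j | _].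
have r0 k : 0 <= p i k / nu i by rewrite divr_ge0.
split=> [[<-]|].
  case: ifPn => [|_ /andP[_ H]]; last by have := le_trans H b1; lra.
  move: (xget _ _) => k; rewrite row_cdfS => /andP[h1 h2] /andP[h3 h4].
  have rk : 0 < p i k / nu i by lra.
  rewrite ltr_pdivlMr// in h3; rewrite ler_pdivrMr// in h4.
  by apply/andP; split; lra.
move=> /andP[h1 h2].
have ar : 0 <= a * (p i j / nu i) by rewrite mulr_ge0.
have br : b * (p i j / nu i) <= p i j / nu i by rewrite ler_piMl.
have rj : 0 < p i j / nu i.
  rewrite lt_def r0 andbT; apply/eqP => z; rewrite z !mulr0 in h1 h2; lra.
have Aj : A j by apply/andP; rewrite row_cdfS; split; lra.
have -> : xget 0%N A = j.
  apply: xget_unique => // j' /andP[g1 g2]; move: Aj => /andP[g3 g4].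
  have [lt|lt|//] := ltngtP j' j; have := row_cdf_mono i p0 nu0 lt.
    by move=> H; exfalso; move: H g2 g3; lra.
  by move=> H; exfalso; move: H g1 g4; lra.
move: Aj => /= ->; split=> //; apply/andP.
by rewrite ltr_pdivlMr// ler_pdivrMr//; split; lra.
Qed.

End nested_intervals.

(** * Laws of the successive states and labels *)

Section markov_chain.
Context {R : realType} {dO : measure_display} {Om : measurableType dO}.
Variable P : probability Om R.
Implicit Types (p : nat -> nat -> R) (nu : nat -> R).

(** Intervals suffice as test sets, because [chain_step] pulls an interval back to one interval for
    each old label. *)
Definition uniform_given nu (s : Om -> nat * R) : Prop :=
  forall i a b, 0 <= a -> a <= b -> b <= 1 ->
    measurable (state_event s i a b) /\ P (state_event s i a b) = (nu i * (b - a))%:E.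

(** [p] holds the joint masses of consecutive labels, not conditional probabilities; the division by
    [nu i] takes place in [row_cdf]. *)
Definition transition p nu nu' : Prop := [/\ forall i j, 0 <= p i j,
  forall i, (\sum_(j <oo) (p i j)%:E = (nu i)%:E)%E &
  forall j, (\sum_(i <oo) (p i j)%:E = (nu' j)%:E)%E].

Lemma transition_nu_ge0 p nu nu' i : transition p nu nu' -> 0 <= nu i.
Proof.
by move=> [p0 rows _]; rewrite -lee_fin -rows; apply: nneseries_ge0 => j _ _; rewrite lee_fin.
Qed.

Lemma transition_partial_le p nu nu' i j : transition p nu nu' ->
  \sum_(l < j) p i l <= nu i.
Proof.
move=> [p0 rows _]; rewrite -lee_fin -rows -sumEFin -(big_mkord xpredT (fun l => (p i l)%:E)).
by apply: nneseries_lim_ge => l _ _; rewrite lee_fin.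
Qed.

Lemma transition_le p nu nu' i j : transition p nu nu' -> p i j <= nu i.
Proof.
move=> tr; apply: le_trans (transition_partial_le i j.+1 tr).
by rewrite big_ord_recr /= lerDr sumr_ge0// => l _; case: tr.
Qed.

Lemma transition_cdf_le1 p nu nu' i j : transition p nu nu' -> row_cdf p nu i j <= 1.
Proof.
move=> tr; rewrite /row_cdf.
have := transition_nu_ge0 i tr; rewrite le_eqVlt => /predU1P[<-|nu0].
  by rewrite invr0 mulr0.
by rewrite ler_pdivrMr// mul1r (transition_partial_le _ _ tr).
Qed.

Lemma uniform_given_cell p nu nu' s i j a b : transition p nu nu' ->
  uniform_given nu s -> 0 <= a -> a <= b -> b <= 1 ->
  let A := state_event s i (row_cdf p nu i j + a * (p i j / nu i))
                           (row_cdf p nu i j + b * (p i j / nu i)) in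
  measurable A /\ P A = (p i j * (b - a))%:E.
Proof.
move=> tr ug a0 ab b1 /=.
have nu0 k := transition_nu_ge0 k tr; have [p0 _ _] := tr.
have r0 : 0 <= p i j / nu i by rewrite divr_ge0.
have c0 := row_cdf_ge0 i j p0 nu0.
have c1 := transition_cdf_le1 i j.+1 tr; rewrite row_cdfS in c1.
have [||| mA PA] := ug i (row_cdf p nu i j + a * (p i j / nu i))
                         (row_cdf p nu i j + b * (p i j / nu i)).
- by rewrite addr_ge0// mulr_ge0.
- by rewrite lerD2l ler_wpM2r.
- by apply: le_trans c1; rewrite lerD2l ler_piMl.
split=> //; rewrite PA; congr (_%:E).
have -> : row_cdf p nu i j + b * (p i j / nu i) - (row_cdf p nu i j + a * (p i j / nu i)) =
   (b - a) * (p i j / nu i) by ring.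
(* If [nu i = 0], the quotient is 0 by convention, and [p i j <= nu i] makes both sides vanish. *)
have := nu0 i; rewrite le_eqVlt => /predU1P[nui|nui].
  have : p i j <= 0 by rewrite [leRHS]nui; exact: transition_le tr.
  move=> pij; have -> : p i j = 0 by apply/le_anti; rewrite pij p0.
  by rewrite !mul0r !mulr0.
by field; rewrite gt_eqF.
Qed.

(** The event for the new state is the disjoint union, over the old label [i], of the cells of
    [uniform_given_cell]; their masses add up to a column sum of [p]. *)
Lemma uniform_given_step p nu nu' s : transition p nu nu' -> uniform_given nu s ->
  uniform_given nu' (chain_step p nu \o s).
Proof.
move=> tr ug j a b a0 ab b1.
have nu0 k := transition_nu_ge0 k tr; have [p0 _ cols] := tr.
pose A i := state_event s i (row_cdf p nu i j + a * (p i j / nu i))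
                            (row_cdf p nu i j + b * (p i j / nu i)).
have -> : state_event (chain_step p nu \o s) j a b = \bigcup_i A i.
  apply/seteqP; split=> x.
    by move=> H; exists (s x).1 => //; split=> //; apply/chain_stepP => //; rewrite -surjective_pairing.
  move=> [i _ [<- H]]; have := (@chain_stepP _ p nu (s x).1 (s x).2 j a b p0 nu0 a0 b1).2 H.
  by rewrite -surjective_pairing.
have cell i := uniform_given_cell i j tr ug a0 ab b1.
split; first by apply: bigcup_measurable => i _; exact: (cell i).1.
rewrite measure_semi_bigcup; last 3 first.
- by move=> i; exact: (cell i).1.
- by move=> i i' _ _ [x [[<- _] [<- _]]].
- by apply: bigcup_measurable => i _; exact: (cell i).1.
rewrite (eq_eseriesr (fun i _ => (cell i).2)).
rewrite EFinM -cols muleC -nneseriesZl; last by move=> i _; rewrite lee_fin.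
by apply: eq_eseriesr => i _; rewrite -EFinM mulrC.
Qed.

Lemma uniform_given_pair p nu nu' s i j : transition p nu nu' -> uniform_given nu s ->
  P (state_event s i 0 1 `&` state_event (chain_step p nu \o s) j 0 1) = (p i j)%:E.
Proof.
move=> tr ug; have nu0 k := transition_nu_ge0 k tr; have [p0 _ _] := tr.
have [_ PA] := uniform_given_cell i j tr ug (lexx 0) ler01 (lexx 1).
rewrite subr0 mulr1 in PA; rewrite -PA; congr (P _); apply/seteqP; split=> x.
  move=> [[xi _] H]; split=> //; rewrite -xi.
  by apply/chain_stepP => //; rewrite -surjective_pairing.
move=> [xi H]; subst i.
have /(@chain_stepP _ p nu (s x).1 (s x).2 j 0 1 p0 nu0 (lexx _) (lexx _)) := H.
rewrite -surjective_pairing => -[H1 H2]; split; split=> //.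
have c0 := row_cdf_ge0 (s x).1 j p0 nu0.
have c1 := transition_cdf_le1 (s x).1 j.+1 tr; rewrite row_cdfS in c1.
by move/andP: H => [h1 h2]; apply/andP; split; lra.
Qed.

Lemma measure_eq_off_null (G A B : set Om) : measurable G -> measurable A ->
  measurable B -> P (~` G) = 0%E -> A `&` G = B `&` G -> P A = P B.
Proof.
move=> mG mA mB G0 AB.
suff H (C : set Om) : measurable C -> P C = P (C `&` G) by rewrite H// AB -H.
move=> mC; rewrite -[in LHS](setIT C) -(setUv G) setIUr measureU//.
- rewrite [X in (_ + X)%E](_ : _ = 0%E) ?adde0//; apply/eqP; rewrite -measure_le0 -G0.
  by apply: le_measure; rewrite ?inE//; [apply: measurableI => //|]; exact: measurableC.
- exact: measurableI.
- by apply: measurableI => //; exact: measurableC.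
- by rewrite setIACA setICr setI0.
Qed.

Lemma exists_chain (nu : nat -> nat -> R) (p : nat -> nat -> nat -> R) s0 :
  uniform_given (nu 0%N) s0 -> (forall k, transition (p k) (nu k) (nu k.+1)) ->
  (forall k, (\sum_(i <oo) (nu k i)%:E = 1)%E) ->
  exists2 J : nat -> Om -> nat, forall k, measurable_fun setT (J k) &
    forall k i j, P [set x | J k x = i /\ J k.+1 x = j] = (p k i j)%:E.
Proof.
move=> ug0 tr nu1.
pose s := nat_rect (fun=> Om -> nat * R) s0 (fun k sk => chain_step (p k) (nu k) \o sk).
have ug k : uniform_given (nu k) (s k).
  by elim: k => [//|k IH]; exact: uniform_given_step (tr k) IH.
have mE k i : measurable (state_event (s k) i 0 1) by have [] := ug k i 0 1 (lexx _) ler01 (lexx _).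
pose good k := \bigcup_i state_event (s k) i 0 1.
have mgood k : measurable (good k) by apply: bigcup_measurable => i _; exact: mE.
have Pgood k : P (good k) = 1%E.
  rewrite /good measure_semi_bigcup; last 3 first.
  - by move=> i; exact: mE.
  - by move=> i i' _ _ [x [[<- _] [<- _]]].
  - exact: mgood.
  rewrite -(nu1 k); apply: eq_eseriesr => i _.
  by have [_] := ug k i 0 1 (lexx _) ler01 (lexx _); rewrite subr0 mulr1.
pose G := \bigcap_k good k.
have mG : measurable G by apply: bigcapT_measurable.
have PG : P (~` G) = 0%E.
  rewrite /G setC_bigcap; apply/eqP; rewrite -measure_le0.
  apply: le_trans (measure_sigma_subadditive _ _ _ (@subset_refl _ _)) _.
  - by move=> k; exact: measurableC.
  - by apply: bigcup_measurable => k _; exact: measurableC.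
  - rewrite eseries0// => k _ _; have := probability_setC P (mgood k).
    by rewrite Pgood subee.
(* [uniform_given] gives measurability of the events [state_event] only, so the label is controlled
   on [G]; off this set of full measure it is reset to 0. *)
pose J k x := if x \in G then (s k x).1 else 0%N.
have mJ k : measurable_fun setT (J k).
  apply: measurable_natP => i.
  rewrite (_ : _ @^-1` _ = (G `&` state_event (s k) i 0 1) `|` (if i == 0%N then ~` G else set0)).
    apply: measurableU; first exact: measurableI.
    by case: ifP => // _; exact: measurableC.
  apply/seteqP; split=> x; rewrite /J /=.
    case: ifPn => [|xG <-]; last by right; rewrite eqxx; move: xG; rewrite notin_setE.
    rewrite inE => xG xi; left; split=> //.
    by have [i' _ [_ ?]] := xG k I; split.
  move=> [[xG [<- _]]|]; first by rewrite mem_set.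
  by case: ifPn => // /eqP -> xG; rewrite memNset.
exists J => // k i j.
rewrite -(uniform_given_pair i j (tr k) (ug k)).
apply: (measure_eq_off_null mG) => //.
- rewrite (_ : [set x | _] = J k @^-1` [set i] `&` J k.+1 @^-1` [set j])//.
  by apply: measurableI; exact: measurable_preimage1.
- by apply: measurableI; [exact: mE|exact: (mE k.+1)].
apply/seteqP; split=> x [] /=.
  move=> [xi xj] xG; split=> //; rewrite /J !mem_set// in xi xj.
  split; first by have [i' _ [_ ?]] := xG k I; split.
  by have [j' _ [_ ?]] := xG k.+1 I; split.
by move=> [[xi _] [xj _]] xG; split=> //; rewrite /J !mem_set.
Qed.

End markov_chain.

(** * Chains on [0, 1] whose consecutive labels follow given couplings *)

Section coupled_chain.
Context {R : realType}.

Lemma uniform_prob_itv (a b : R) : 0 <= a -> a <= b -> b <= 1 ->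
  uniform_prob (@ltr01 R) `]a, b]%classic = (b - a)%:E.
Proof.
move=> a0 ab b1; rewrite /uniform_prob (eq_integral (cst 1%E)).
  rewrite integral_cst//= mul1e lebesgue_measure_itv/= lte_fin.
  by move: ab; rewrite le_eqVlt => /predU1P[->|->//]; rewrite ltxx subrr.
move=> x; rewrite inE/= in_itv/= => /andP[ax xb]; rewrite /uniform_pdf.
by rewrite (ltW (le_lt_trans a0 ax)) (le_trans xb b1) subr0 invr1.
Qed.

(** The cell masses of [g k] form a [transition] because its marginals are [mu k] and [mu k.+1]. As
    [q 0] is constant, the initial state [(0, x)] with [x] uniform satisfies [uniform_given]. *)
Lemma exists_coupled_chain dT (S : measurableType dT) (mu : nat -> probability S R)
    (g : nat -> probability (S * S)%type R) (q : nat -> S -> nat) :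
  (forall k, is_push measurable (g k) fst measurable (mu k)) ->
  (forall k, is_push measurable (g k) snd measurable (mu k.+1)) ->
  (forall k, measurable_fun setT (q k)) -> q 0%N = cst 0%N ->
  exists2 J : nat -> measurableTypeR R -> nat, forall k, measurable_fun setT (J k) &
    forall k i j, uniform_prob (@ltr01 R) [set x | J k x = i /\ J k.+1 x = j] =
      g k [set z | q k z.1 = i /\ q k.+1 z.2 = j].
Proof.
move=> g1 g2 mq q0.
pose nu k i := fine (mu k (q k @^-1` [set i])).
have mqk k i : measurable (q k @^-1` [set i]) by exact: measurable_preimage1.
have nuE k i : (nu k i)%:E = mu k (q k @^-1` [set i]) by rewrite fineK ?fin_num_measure.
pose cell k i j : set (S * S) := [set z | q k z.1 = i /\ q k.+1 z.2 = j].
have m1 k : measurable_fun setT (q k \o fst : S * S -> nat) by exact: measurableT_comp.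
have m2 k : measurable_fun setT (q k.+1 \o snd : S * S -> nat) by exact: measurableT_comp.
have cellE k i j : cell k i j = (q k \o fst) @^-1` [set i] `&` (q k.+1 \o snd) @^-1` [set j].
  by [].
have mcell k i j : measurable (cell k i j).
  by rewrite cellE; apply: measurableI; exact: measurable_preimage1.
pose p k i j := fine (g k (cell k i j)).
have pE k i j : (p k i j)%:E = g k (cell k i j) by rewrite fineK ?fin_num_measure.
have tr k : transition (p k) (nu k) (nu k.+1).
  split=> [i j|i|j]; first by rewrite fine_ge0.
    rewrite nuE (g1 k)// (measure_nat_partition (g k) (m2 k)); last exact: (measurable_preimage1 i (m1 k)).
    by apply: eq_eseriesr => j _; rewrite pE.
  rewrite nuE (g2 k)// (measure_nat_partition (g k) (m1 k)); last exact: (measurable_preimage1 j (m2 k)).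
  by apply: eq_eseriesr => i _; rewrite pE cellE setIC.
have nu1 k : (\sum_(i <oo) (nu k i)%:E = 1)%E.
  rewrite -(probability_setT (mu k)) (measure_nat_partition (mu k) (mq k))//.
  by apply: eq_eseriesr => i _; rewrite nuE setTI.
pose s0 (x : measurableTypeR R) : nat * R := (0%N, x).
have ug0 : uniform_given (uniform_prob (@ltr01 R)) (nu 0%N) s0.
  move=> [|i] a b a0 ab b1; rewrite /state_event /s0 /=.
    rewrite (_ : [set x | _] = `]a, b]%classic); last first.
      by apply/seteqP; split=> x /=; rewrite in_itv/=; [case|].
    split=> //; rewrite uniform_prob_itv//; congr (_%:E).
    rewrite /nu q0 (_ : _ @^-1` _ = setT) ?probability_setT ?mul1r//.
    by apply/seteqP; split.
  rewrite (_ : [set x | _] = set0); last by apply/seteqP; split=> x // [].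
  split=> //; rewrite measure0 /nu q0 (_ : _ @^-1` _ = set0) ?measure0 ?mul0r//.
  by apply/seteqP; split.
have [J mJ JE] := exists_chain ug0 tr nu1.
by exists J => // k i j; rewrite JE pE.
Qed.

End coupled_chain.

(** * Completeness of the Wasserstein distance *)

Section completeness.
Context {R : realType} {d : nat}.
Local Notation T := (Rd R d).
Local Notation prob X := (probability X R).

(** The sequence is squeezed between an increasing and a decreasing one, at distance
    [2 * C * 2 ^- k], the sum of the remaining steps. *)
Lemma geometric_cauchy_cvg (u : nat -> R) (C : R) : 0 <= C ->
  (forall k, `|u k - u k.+1| <= C * 2 ^- k) ->
  exists2 l, u @ \oo --> l & forall k, `|u k - l| <= 2 * C * 2 ^- k.
Proof.
move=> C0 uC.
have e0 k : 0 < 2 ^- k :> R by rewrite invr_gt0 exprn_gt0.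
have eS k : 2 ^- k.+1 = 2 ^- k / 2 :> R by rewrite exprS invfM mulrC.
pose v k := u k - 2 * C * 2 ^- k; pose w k := u k + 2 * C * 2 ^- k.
have vS k : v k <= v k.+1.
  by rewrite /v eS; have := uC k; rewrite ler_norml => /andP[]; lra.
have wS k : w k.+1 <= w k.
  by rewrite /w eS; have := uC k; rewrite ler_norml => /andP[]; lra.
have vw k : v k <= w k by have := mulr_ge0 C0 (ltW (e0 k)); rewrite /v /w; lra.
have vm m n : (m <= n)%N -> v m <= v n.
  elim: n => [|n IH]; first by rewrite leqn0 => /eqP ->.
  by rewrite leq_eqVlt => /predU1P[->//|]; rewrite ltnS => /IH /le_trans; apply.
have wm m n : (m <= n)%N -> w n <= w m.
  elim: n => [|n IH]; first by rewrite leqn0 => /eqP ->.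
  by rewrite leq_eqVlt => /predU1P[->//|]; rewrite ltnS => /IH; apply: le_trans.
have vwmn m n : v m <= w n.
  apply: le_trans (vm _ _ (leq_maxl m n)) _; apply: le_trans (vw _) _.
  exact: wm (leq_maxr m n).
have hv : has_sup (range v).
  by split; [exists (v 0%N); exists 0%N|exists (w 0%N) => _ [m _ <-]].
have vl k : v k <= sup (range v) by apply: sup_upper_bound => //; exists k.
have lw k : sup (range v) <= w k by apply: ge_sup; [case: hv|move=> _ [m _ <-]].
have H k : `|u k - sup (range v)| <= 2 * C * 2 ^- k.
  by have := (vl k, lw k) => -[]; rewrite /v /w ler_norml => ? ?; apply/andP; split; lra.
exists (sup (range v)) => //; apply/cvgrPdist_le => eps eps0.
pose M := 2 * C / eps; exists (Num.truncn M) => // k /= Mk.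
have Mk' : M <= k.+1%:R by have /ltW/le_trans := truncnS_gt M; apply; rewrite ler_nat.
have : M <= 2 ^+ k by apply: le_trans Mk' _; rewrite -natrX ler_nat ltn_expl.
rewrite ler_pdivrMr// => Ck; rewrite distrC; apply: le_trans (H k) _.
by rewrite ler_pdivrMr ?exprn_gt0// mulrC [leRHS]mulrC mulrC.
Qed.

Lemma integral_same_pair_law d1 d2 (S1 : measurableType d1) (S2 : measurableType d2)
    (P1 : prob S1) (P2 : prob S2) (f1 g1 : S1 -> nat) (f2 g2 : S2 -> nat)
    (phi : nat -> nat -> \bar R) :
  measurable_fun setT f1 -> measurable_fun setT g1 ->
  measurable_fun setT f2 -> measurable_fun setT g2 ->
  (forall i j, 0 <= phi i j)%E ->
  (forall i j, P1 [set x | f1 x = i /\ g1 x = j] = P2 [set x | f2 x = i /\ g2 x = j]) ->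
  (\int[P1]_x phi (f1 x) (g1 x) = \int[P2]_x phi (f2 x) (g2 x))%E.
Proof.
move=> mf1 mg1 mf2 mg2 phi0 E12.
pose pk (x : nat * nat) := choice.pickle x.
pose psi n := if choice.unpickle n is Some (i, j) then phi i j else 0%E.
have psiE i j : psi (pk (i, j)) = phi i j by rewrite /psi choice.pickleK.
have psi0 n : (0 <= psi n)%E by rewrite /psi; case: choice.unpickle => // -[].
have preE (S : Type) (f g : S -> nat) i j :
    (fun x => pk (f x, g x)) @^-1` [set pk (i, j)] = [set x | f x = i /\ g x = j].
  apply/seteqP; split=> x /= [].
    by move=> /(pcan_inj choice.pickleK)[-> ->].
  by move=> -> ->.
have mpk dS (S : measurableType dS) (f g : S -> nat) : measurable_fun setT f ->
    measurable_fun setT g -> measurable_fun setT (fun x => pk (f x, g x)).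
  move=> mf mg; apply: measurable_natP => k.
  have [[[i j] <-]|none] := pselect (exists x, pk x = k).
    rewrite preE (_ : [set x | _] = f @^-1` [set i] `&` g @^-1` [set j])//.
    by apply: measurableI; exact: measurable_preimage1.
  rewrite (_ : _ @^-1` _ = set0)//; apply/seteqP; split=> // x /= xk.
  by apply: none; exists (f x, g x).
under eq_integral do rewrite -psiE.
under [RHS]eq_integral do rewrite -psiE.
rewrite (integral_nat_valued P1 (mpk _ _ _ _ mf1 mg1) psi0).
rewrite (integral_nat_valued P2 (mpk _ _ _ _ mf2 mg2) psi0).
apply: eq_eseriesr => k _; congr (_ * _)%E.
have [[[i j] <-]|none] := pselect (exists x, pk x = k); first by rewrite !preE E12.
have e0 (S : Type) (f g : S -> nat) : (fun x => pk (f x, g x)) @^-1` [set k] = set0.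
  by apply/seteqP; split=> // x /= xk; apply: none; exists (f x, g x).
by rewrite !e0 !measure0.
Qed.

Lemma sqdistxx (x : T) : sqdist x x = 0.
Proof. by apply: big1 => i _; rewrite subrr expr0n. Qed.

Lemma coord_le_sqdist (x y : T) i : (x ord0 i - y ord0 i) ^+ 2 <= sqdist x y.
Proof. by rewrite /sqdist (bigD1 i)//= lerDl sumr_ge0// => j _; exact: sqr_ge0. Qed.

(** Each coordinate moves by at most [sqrt y * 2 ^- k], so its squared error is at most
    [4 * 4 ^- k * y]; there are [d] coordinates. *)
Lemma sqdist_cauchy_cvg (x : nat -> T) (y : R) : 0 <= y ->
  (forall k, 4 ^+ k * sqdist (x k) (x k.+1) <= y) ->
  exists l : T, (forall i, x k ord0 i @[k --> \oo] --> l ord0 i) /\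
    forall k, sqdist (x k) l <= 4 * d%:R * 4 ^- k * y.
Proof.
move=> y0 H; pose C := Num.sqrt y; have C0 : 0 <= C := sqrtr_ge0 _.
have CC : C ^+ 2 = y by exact: sqr_sqrtr.
have e4 k : 4 ^+ k = (2 ^+ k) ^+ 2 :> R by rewrite -exprM mulnC exprM; congr (_ ^+ _); ring.
have e0 k : 0 < 2 ^+ k :> R by rewrite exprn_gt0.
have step i k : `|x k ord0 i - x k.+1 ord0 i| <= C * 2 ^- k.
  rewrite -ler_sqr ?nnegrE ?mulr_ge0 ?invr_ge0 ?(ltW (e0 k))//.
  rewrite real_normK ?num_real// exprMn CC exprVn -e4 ler_pdivlMr ?exprn_gt0//.
  apply: le_trans (H k); rewrite mulrC ler_pM2l ?exprn_gt0//; exact: coord_le_sqdist.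
have lP i : exists l, x k ord0 i @[k --> \oo] --> l /\
    forall k, `|x k ord0 i - l| <= 2 * C * 2 ^- k.
  by have [l ? ?] := geometric_cauchy_cvg C0 (step i); exists l.
have [l lH] := choice lP.
exists (\row_i l i); split=> [i|k]; first by rewrite mxE; exact: (lH i).1.
rewrite /sqdist; apply: le_trans (_ : \sum_(i < d) (4 * 4 ^- k * y) <= _).
  apply: ler_sum => i _; rewrite mxE.
  rewrite -(real_normK (num_real (_ - _))).
  have b0 : 0 <= 2 * C * 2 ^- k by rewrite mulr_ge0 ?mulr_ge0 ?invr_ge0 ?(ltW (e0 k)).
  have : `|x k ord0 i - l i| ^+ 2 <= (2 * C * 2 ^- k) ^+ 2.
    by rewrite ler_sqr ?nnegrE//; exact: (lH i).2.
  move=> /le_trans; apply.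
  by rewrite !exprMn CC exprVn -e4 -natrX; lra.
rewrite sumr_const card_ord -[_ *+ d]mulr_natr; lra.
Qed.

End completeness.

Section wasserstein_complete.
Context {R : realType} {d : nat}.
Local Notation T := (Rd R d).
Local Notation prob X := (probability X R).

(* Prepending the one-cell partition provides the deterministic initial state
   required by [exists_coupled_chain]. *)
Lemma shifted_coupled_chain (mu : nat -> prob T) (g : nat -> prob (T * T)%type)
    (q : nat -> T -> nat) :
  (forall k, coupling (g k) (mu k) (mu k.+1)) ->
  (forall k, measurable_fun setT (q k)) ->
  exists2 J : nat -> measurableTypeR R -> nat, forall k, measurable_fun setT (J k) &
    forall k i j, uniform_prob (@ltr01 R) [set x | J k x = i /\ J k.+1 x = j] =
      g k [set z | q k z.1 = i /\ q k.+1 z.2 = j].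
Proof.
move=> cg mq.
have mdiag : measurable_fun setT (fun x : T => (x, x)) by exact: measurable_fun_pair.
have [g0 g0E] := probability_push (mu 0%N) mdiag.
pose mu' k := mu k.-1.
pose g' k := if k is k'.+1 then g k' else g0.
pose q' k := if k is k'.+1 then q k' else cst 0%N.
have [||||J' mJ' J'E] := @exists_coupled_chain R _ _ mu' g' q'.
- move=> [|k] A mA /=; first by rewrite g0E.
  by have /couplingP[H _] := cg k; exact: H.
- move=> [|k] A mA /=; first by rewrite g0E.
  by have /couplingP[_ H] := cg k; exact: H.
- by move=> [|k] /=.
- by [].
by exists (fun k => J' k.+1) => // k i j; exact: (J'E k.+1).
Qed.

Lemma nneseries_geometric_le (u : nat -> \bar R) (C : R) : 0 <= C ->
  (forall k, 0 <= u k)%E -> (forall k, u k <= (C * 4 ^- k)%:E)%E ->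
  (\sum_(k <oo) u k <= (2 * C)%:E)%E.
Proof.
move=> C0 u0 uC; apply: lime_le; first exact: is_cvg_nneseries.
apply: nearW => n; apply: (@le_trans _ _ (2 * C - 2 * C * 4 ^- n)%:E); last first.
  by rewrite lee_fin lerBlDr lerDl !mulr_ge0// invr_ge0 exprn_ge0.
elim: n => [|n IH]; first by rewrite big_geq// lee_fin expr0 invr1; lra.
rewrite big_nat_recr//=; apply: le_trans (leeD IH (uC n)) _.
rewrite -EFinD lee_fin exprS invfM.
have : 0 <= C * 4 ^- n by rewrite mulr_ge0// invr_ge0 exprn_ge0.
lra.
Qed.

(** Squared steps of order [16 ^- k], weighted by [4 ^+ k], still have an integrable sum [Y], and
    where [Y] is finite the path is Cauchy at rate [2 ^- k]. Gluing [mu k] with the chain along the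
    label at time [k] then compares it with the limit. *)
Lemma W2sq_complete (mu : nat -> prob T) (g : nat -> prob (T * T)%type) :
  (forall k, coupling (g k) (mu k) (mu k.+1)) ->
  (forall k, cost (g k) <= (16 ^- k)%:E)%E ->
  exists m : prob T, exists2 C : R, 0 <= C &
    forall k, (W2sq (mu k) m <= (C * 4 ^- k)%:E)%E.
Proof.
move=> cg costg.
have e16 k : 0 < 16 ^- k :> R by rewrite invr_gt0 exprn_gt0.
have e4 k : 0 < 4 ^- k :> R by rewrite invr_gt0 exprn_gt0.
have e16S k : 16 ^- k.+1 <= 16 ^- k :> R.
  by rewrite exprS invfM ler_piMl ?(ltW (e16 k))//; lra.
have e16E k : 16 ^- k = 4 ^- k * 4 ^- k :> R.
  by rewrite -invfM -exprMn; congr (_ ^- _); ring.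
have qP k : exists q : T -> nat, measurable_fun setT q /\
    forall x y, q x = q y -> sqdist x y <= 16 ^- k.
  by have [q ? ?] := @exists_cells R d _ (e16 k); exists q.
have [q qH] := choice qP.
have mq k := (qH k).1.
have [J mJ JE] := shifted_coupled_chain cg mq.
pose P : prob (measurableTypeR R) := uniform_prob (@ltr01 R).
pose c k i : T := xget point [set x | q k x = i].
have cP k x : sqdist x (c k (q k x)) <= 16 ^- k.
  apply: (qH k).2; apply/esym.
  by apply: (@xgetPex _ _ [set y | q k y = q k x]); exists x.
pose X k w : T := c k (J k w).
have mX k : measurable_fun setT (X k) by exact: (measurableT_comp (f := c k)).
pose D k w := sqdist (X k w) (X k.+1 w).
have mD k : measurable_fun setT (D k) by exact: measurable_sqdist.
have D0 k w : 0 <= D k w by exact: sqdist_ge0.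
(* Moving each endpoint to the representative of its cell costs at most [16 ^- k], hence
   [3 * (2 + 1) = 9]. *)
have intD k : (\int[P]_w (D k w)%:E <= (9 * 16 ^- k)%:E)%E.
  have -> : (\int[P]_w (D k w)%:E =
      \int[g k]_z (sqdist (c k (q k z.1)) (c k.+1 (q k.+1 z.2)))%:E)%E.
    have mq1 : measurable_fun setT (fun z : T * T => q k z.1).
      exact: (measurableT_comp (mq k)).
    have mq2 : measurable_fun setT (fun z : T * T => q k.+1 z.2).
      exact: (measurableT_comp (mq k.+1)).
    apply: (integral_same_pair_law (P1 := P) (P2 := g k)
      (phi := fun i j => (sqdist (c k i) (c k.+1 j))%:E) (mJ k) (mJ k.+1) mq1 mq2).
      by move=> i j; rewrite lee_fin sqdist_ge0.
    exact: JE.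
  have mcq l : measurable_fun setT (fun x => c l (q l x)).
    exact: (measurableT_comp (f := c l)).
  apply: (@le_trans _ _ (\int[g k]_z (3%:E * ((2 * 16 ^- k)%:E + (sqdist z.1 z.2)%:E)))%E).
    apply: ge0_le_integral => //=.
    - by move=> z _; rewrite lee_fin sqdist_ge0.
    - apply/measurable_EFinP; apply: measurable_sqdist.
        exact: (measurableT_comp (mcq k)).
      exact: (measurableT_comp (mcq k.+1)).
    - apply: measurable_funeM; apply: emeasurable_funD => //.
      by apply/measurable_EFinP; exact: measurable_sqdist.
    move=> z _; rewrite -EFinD -EFinM lee_fin.
    apply: le_trans (sqdist_triangle3 _ z.1 z.2 _) _; rewrite ler_pM2l//.
    have := cP k z.1; have := cP k.+1 z.2; have := e16S k.
    by rewrite (sqdistC z.1 (c _ _)); lra.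
  rewrite ge0_integralZl//=; last 2 first.
  - by apply: emeasurable_funD => //; apply/measurable_EFinP; exact: measurable_sqdist.
  - by move=> z _; rewrite -EFinD lee_fin addr_ge0 ?sqdist_ge0// mulr_ge0// ltW.
  rewrite ge0_integralD//=; last 2 first.
  - by move=> z _; rewrite lee_fin sqdist_ge0.
  - by apply/measurable_EFinP; exact: measurable_sqdist.
  rewrite integral_cst//= probability_setT mule1.
  have -> : (9 * 16 ^- k)%:E = (3%:E * ((2 * 16 ^- k)%:E + (16 ^- k)%:E))%E :> \bar R.
    by rewrite -EFinD -EFinM; congr (_%:E); ring.
  by apply: lee_pmul => //; [rewrite adde_ge0 ?cost_ge0 ?lee_fin ?mulr_ge0 ?(ltW (e16 k))
                            |exact: leeD2l (costg k)].
pose Y w := (\sum_(k <oo) (4 ^+ k * D k w)%:E)%E.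
have t0 k w : (0 <= (4 ^+ k * D k w)%:E)%E by rewrite lee_fin mulr_ge0// exprn_ge0.
have mt k : measurable_fun setT (fun w => (4 ^+ k * D k w)%:E).
  by apply/measurable_EFinP; exact: measurable_funM.
have Y0 w : (0 <= Y w)%E by apply: nneseries_ge0.
have mY : measurable_fun setT Y by apply: ge0_emeasurable_sum.
have intY : (\int[P]_w Y w <= 18%:E)%E.
  rewrite integral_nneseries//.
  have -> : 18%:E = (2 * 9)%:E :> \bar R by congr (_%:E); ring.
  apply: nneseries_geometric_le => // [k|k]; first exact: integral_ge0.
  under eq_integral do rewrite EFinM.
  rewrite ge0_integralZl_EFin ?exprn_ge0//; last 2 first.
  - by move=> w _; rewrite lee_fin.
  - exact/measurable_EFinP.
  have p4 : (0 <= (4 ^+ k)%:E :> \bar R)%E by rewrite lee_fin exprn_ge0.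
  apply: le_trans (lee_wpmul2l p4 (intD k)) _.
  rewrite -EFinM lee_fin e16E.
  have -> // : 4 ^+ k * (9 * (4 ^- k * 4 ^- k)) = 9 * 4 ^- k :> R.
  have : 4 ^+ k != 0 :> R by rewrite expf_neq0.
  by move: (4 ^+ k : R) => x x0; field.
pose A := [set w | (Y w < +oo)%E].
have mA : measurable A by rewrite -[A]setTI; exact: emeasurable_fun_infty_o.
(* [4 * d] comes from [sqdist_cauchy_cvg]; the 1 keeps [K] positive for [d = 0], so that the bound
   below is [+oo] wherever [Y] is. *)
pose K : R := 4 * d%:R + 1.
have K0 : 0 < K by rewrite ltr_wpDl// mulr_ge0.
(* The indicator of [A] makes the coordinates converge at every [w], which yields a measurable
   limit; where [Y w] is infinite the limit is 0 and the bound is trivial. *)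
have lP w : exists l : T, (forall i, X k w ord0 i * \1_A w @[k --> \oo] --> l ord0 i) /\
    forall k, ((sqdist (X k w) l)%:E <= (K * 4 ^- k)%:E * Y w)%E.
  have [Yw|Yw] := ltP (Y w) +oo%E.
    have Yf : (fine (Y w))%:E = Y w by rewrite fineK// ge0_fin_numE.
    have y0 : 0 <= fine (Y w) by rewrite fine_ge0.
    have [k|l [lc lb]] := @sqdist_cauchy_cvg _ _ (X ^~ w) _ y0.
      rewrite -lee_fin Yf; apply: le_trans (nneseries_lim_ge k.+1 _) => //.
      by rewrite big_nat_recr//= leeDr// sume_ge0.
    exists l; split=> [i|k].
      by rewrite indicE mem_set//=; under eq_fun do rewrite mulr1; exact: lc.
    rewrite -Yf -EFinM lee_fin; apply: le_trans (lb k) _.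
    by apply: ler_wpM2r => //; apply: ler_wpM2r; [exact: ltW|rewrite /K; lra].
  exists 0; split=> [i|k].
    rewrite indicE memNset ?mxE; last by rewrite /A /= => /(le_lt_trans Yw); rewrite ltxx.
    by under eq_fun do rewrite mulr0; exact: cvg_cst.
  move: Yw; rewrite leye_eq => /eqP ->.
  by rewrite gt0_muley ?leey// lte_fin mulr_gt0.
have [Xl XlH] := choice lP.
have mXl : measurable_fun setT Xl.
  apply: measurable_Rd => i.
  apply: (@measurable_fun_cvg _ _ _ setT (fun k w => X k w ord0 i * \1_A w)).
    move=> k; apply: measurable_funM; last exact: measurable_indic.
    exact: (measurableT_comp (measurable_coord i)).
  by move=> w _; exact: (XlH w).1.
have [m mE] := probability_push P mXl.
exists m; exists (3 * (1 + K * 18)).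
  by rewrite mulr_ge0// addr_ge0// mulr_ge0// ltW.
move=> k.
(* Both masses are sums over the label at time [k.+1] of the pair masses, which agree. *)
have law i : mu k (q k @^-1` [set i]) = P (J k @^-1` [set i]).
  have /couplingP[g1 _] := cg k.
  rewrite g1; last exact: measurable_preimage1.
  have mq2 : measurable_fun setT (q k.+1 \o snd : T * T -> nat) by exact: measurableT_comp.
  have mq1 : measurable_fun setT (q k \o fst : T * T -> nat) by exact: measurableT_comp.
  rewrite (measure_nat_partition (g k) mq2); last exact: (measurable_preimage1 i mq1).
  rewrite (measure_nat_partition P (mJ k.+1)); last exact: measurable_preimage1.
  by apply: eq_eseriesr => j _; exact: esym (JE k i j).
have [G [G1 G2 Gq]] := nat_gluing (mq k) (mJ k) law.
have mfst : measurable_fun setT (fun z : T * measurableTypeR R => z.1) by exact: measurable_fst.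
have msnd : measurable_fun setT (fun z : T * measurableTypeR R => z.2) by exact: measurable_snd.
have mXl2 : measurable_fun setT (fun z : T * measurableTypeR R => Xl z.2).
  exact: (measurableT_comp mXl).
have mY2 : measurable_fun setT (fun z : T * measurableTypeR R => Y z.2).
  exact: (measurableT_comp mY).
have Gm : is_push measurable G (fun z => Xl z.2) measurable m.
  apply: (is_push_comp (f := snd) mXl G2) => B mB; exact: mE.
apply: le_trans (W2sq_le_push mfst mXl2 G1 Gm) _.
have KY0 w : (0 <= (K * 4 ^- k)%:E * Y w)%E.
  by rewrite mule_ge0// lee_fin mulr_ge0// ltW.
have mKY : measurable_fun setT (fun z : T * measurableTypeR R => ((K * 4 ^- k)%:E * Y z.2)%E).
  exact: measurable_funeM.
apply: (@le_trans _ _ (\int[G]_z (3%:E * ((16 ^- k)%:E + (K * 4 ^- k)%:E * Y z.2)))%E).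
  apply: ae_ge0_le_integral => //=.
  - by move=> z _; rewrite lee_fin sqdist_ge0.
  - by apply/measurable_EFinP; exact: measurable_sqdist.
  - by move=> z _; rewrite mule_ge0// adde_ge0// lee_fin ltW.
  - by apply: measurable_funeM; apply: emeasurable_funD.
  apply: filterS Gq => z /= zq _.
  have : ((sqdist z.1 (Xl z.2))%:E <=
      3%:E * ((sqdist z.1 (X k z.2))%:E + (sqdist (X k z.2) (Xl z.2))%:E))%E.
    rewrite -EFinD -EFinM lee_fin.
    have := sqdist_triangle3 z.1 (X k z.2) (X k z.2) (Xl z.2).
    by rewrite (sqdistxx (X k z.2)) addr0.
  move=> /le_trans; apply; apply: lee_wpmul2l => //; apply: leeD.
    by rewrite lee_fin /X -zq; exact: cP.
  exact: (XlH z.2).2.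
rewrite ge0_integralZl//=; last 2 first.
- exact: emeasurable_funD.
- by move=> z _; rewrite adde_ge0// lee_fin ltW.
rewrite ge0_integralD//=.
rewrite integral_cst//= probability_setT mule1.
rewrite ge0_integralZl_EFin//; last by rewrite mulr_ge0// ltW.
rewrite -(is_push_integral (f := snd) _ G2)//.
have kk : ((K * 4 ^- k)%:E * \int[P]_w Y w <= (K * 4 ^- k)%:E * 18%:E)%E.
  by apply: lee_wpmul2l => //; rewrite lee_fin mulr_ge0// ltW.
have h1 : 16 ^- k <= 4 ^- k :> R.
  rewrite e16E ler_piMl ?(ltW (e4 k))//.
  by rewrite -[leRHS]invr1 lef_pV2 ?posrE ?exprn_gt0// exprn_ege1//; lra.
have h2 : ((16 ^- k)%:E + (K * 4 ^- k)%:E * \int[P]_w Y w <=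
    (4 ^- k)%:E + (K * 4 ^- k)%:E * 18%:E)%E by apply: leeD => //; rewrite lee_fin.
have p3 : (0 <= 3%:E :> \bar R)%E by [].
apply: le_trans (lee_wpmul2l p3 h2) _.
by rewrite -[X in (_ + X)%E]EFinM -EFinD -EFinM lee_fin; lra.
Qed.

End wasserstein_complete.

Lemma limn_einf_le (R : realType) (u : nat -> \bar R) (c : \bar R) :
  (exists N, forall j, (N <= j)%N -> u j <= c)%E -> (limn_einf u <= c)%E.
Proof.
move=> [N HN]; rewrite limn_einf_lim; apply: lime_le; first exact: is_cvg_einfs.
apply: nearW => n; apply: ge_ereal_inf; exists (u (maxn n N)).
  by exists (maxn n N) => //=; exact: leq_maxl.
by apply: HN; exact: leq_maxr.
Qed.

(** * The Wasserstein space as an instance of the abstract scheme *)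

Section wasserstein_gradient_flow.
Context {R : realType} {d : nat}.
Local Notation T := (Rd R d).
Local Notation prob X := (probability X R).
Variables (om0 : prob T) (E : prob T -> \bar R) (lam : R).
Hypothesis E_noninf : forall mu, P2 om0 mu -> E mu != -oo%E.
Hypothesis Ecoer : is_coercive om0 E.
Hypothesis Elsc : is_W2_lsc om0 E.
Hypothesis Econv : is_convex_gen_geod om0 E lam.

Let Dom mu := P2 om0 mu /\ (E mu < +oo)%E.
Let D (mu nu : prob T) : R := fine (W2sq mu nu).
Let e mu : R := fine (E mu).
Let k := lam_minus lam.
Local Notation dist x y := (Num.sqrt (D x y)).

Let EE mu : Dom mu -> E mu = (e mu)%:E.
Proof.
by move=> [Pmu Emu]; rewrite fineK// fin_numE E_noninf//= lt_eqF.
Qed.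

Let W2sq_P2 mu nu : P2 om0 mu -> P2 om0 nu -> (W2sq mu nu < +oo)%E.
Proof.
move=> Pmu Pnu; have Pnu' : (W2sq om0 nu < +oo)%E by rewrite W2sq_sym.
apply: le_lt_trans (W2sq_quasi_triangle Pmu Pnu') _.
by rewrite -(W2sq_fineK Pmu) -(W2sq_fineK Pnu') -!EFinD -EFinM ltry.
Qed.

Let P2_trans mu nu : P2 om0 mu -> (W2sq mu nu < +oo)%E -> P2 om0 nu.
Proof.
move=> Pmu; rewrite W2sq_sym => fin.
apply: le_lt_trans (W2sq_quasi_triangle fin Pmu) _.
by rewrite -(W2sq_fineK Pmu) -(W2sq_fineK fin) -!EFinD -EFinM ltry.
Qed.

Let DE mu nu : P2 om0 mu -> P2 om0 nu -> W2sq mu nu = (D mu nu)%:E.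
Proof. by move=> Pmu Pnu; rewrite /D W2sq_fineK// W2sq_P2. Qed.

Let W2E mu nu : P2 om0 mu -> P2 om0 nu -> W2 mu nu = (dist mu nu)%:E.
Proof. by move=> Pmu Pnu; rewrite /W2 DE. Qed.

Let D_ge0 mu nu : 0 <= D mu nu. Proof. by rewrite fine_ge0// W2sq_ge0. Qed.

Let D_sym mu nu : D mu nu = D nu mu. Proof. by rewrite /D W2sq_sym. Qed.

Let D_diag mu : D mu mu = 0. Proof. by rewrite /D W2sq_diag. Qed.

Let gen_geod o x y : Dom o -> Dom x -> Dom y ->
  exists2 Dw, D x y <= Dw & forall a : R, 0 <= a <= 1 -> exists z,
    [/\ Dom z, e z <= (1 - a) * e x + a * e y - a * (1 - a) * lam / 2 * Dw
      & D o z <= (1 - a) * D o x + a * D o y - a * (1 - a) * Dw].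
Proof.
move=> [Po Eo] dx dy; have [Px Py] := (dx.1, dy.1).
have [w [tw conv]] := Econv Px Py Po.
have [wfin xyw interp] := transport_plan_interpolation tw (W2sq_P2 Po Px) (W2sq_P2 Po Py).
pose Dw := fine (W2plan_sq w).
have wE : W2plan_sq w = Dw%:E.
  rewrite fineK// ge0_fin_numE//; exact: le_trans (W2sq_ge0 _ _) xyw.
have Dw0 : 0 <= Dw by rewrite fine_ge0//; exact: le_trans (W2sq_ge0 _ _) xyw.
exists Dw; first by rewrite -lee_fin -wE -DE.
move=> a a01; have [z [wz Ez]] := conv a a01.
have := interp a z a01 wz; rewrite wE (DE Po Px) (DE Po Py) -!EFinM -EFinD => oz.
have Pz : P2 om0 z.
  apply: (P2_trans Po); have := ltry ((1 - a) * D o x + a * D o y); apply: le_lt_trans.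
  apply: le_trans oz; rewrite leeDl// lee_fin mulr_ge0//.
  by case/andP: a01 => a0 a1; rewrite mulr_ge0// subr_ge0.
have {}Ez : (E z <= ((1 - a) * e x + a * e y - a * (1 - a) * lam / 2 * Dw)%:E)%E.
  by move: Ez; rewrite (EE dx) (EE dy) wE.
have dz : Dom z by split=> //; apply: le_lt_trans Ez _; exact: ltry.
exists z; split=> //; first by rewrite -lee_fin -EE.
by move: oz; rewrite DE// -EFinD lee_fin; lra.
Qed.

(** The point [u0] of coercivity may have infinite energy and so lie outside [Dom]; the rough
    triangle inequality moves the quadratic bound to [mu]. *)
Let lower_bound mu : Dom mu -> exists p c C,
  [/\ Dom p, 0 <= c & forall v, Dom v -> - C - c * D p v <= e v].
Proof.
move=> dmu; have [tau0 [tau00 [u0 [Pu0 infE]]]] := Ecoer.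
have [C CP] : exists C : R, forall v, Dom v -> C <= (2 * tau0)^-1 * D u0 v + e v.
  have lb v : Dom v -> (ereal_inf [set c | exists v, P2 om0 v /\
        c = ((2 * tau0)^-1)%:E * W2sq u0 v + E v]
        <= ((2 * tau0)^-1 * D u0 v + e v)%:E)%E.
    move=> dv; apply: ereal_inf_lbound; exists v; split; first exact: dv.1.
    by rewrite (EE dv) DE//; case: dv.
  move: infE lb; case: ereal_inf => [r _ lb|_ lb|//].
    by exists r => v /lb; rewrite lee_fin.
  by exists 0 => v /lb; rewrite leye_eq.
pose c := (2 * tau0)^-1 * 3.
have c0 : 0 <= c by rewrite mulr_ge0// invr_ge0 mulr_ge0// ltW.
exists mu, c, (- C + c * (D u0 mu + 3)); split=> // v dv; have := CP _ dv.
have := W2sq_quasi_triangle (W2sq_P2 Pu0 dmu.1) (W2sq_P2 dmu.1 dv.1).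
rewrite !DE//; [|by case: dmu|by case: dv|by case: dmu|by case: dv].
rewrite -!EFinD -EFinM lee_fin => H.
have := ler_wpM2l (_ : 0 <= (2 * tau0)^-1) H; rewrite invr_ge0 mulr_ge0 ?(ltW tau00)//.
by move=> /(_ isT); rewrite /c; lra.
Qed.

Let complete_lsc (v : nat -> prob T) : (forall j, Dom (v j)) ->
  (forall j, D (v j) (v j.+1) <= 16 ^- j) ->
  (exists B, forall j, e (v j) <= B) ->
  exists z, [/\ Dom z,
    forall eps, 0 < eps -> exists N, forall j, (N <= j)%N -> dist (v j) z <= eps
    & forall c, (exists N, forall j, (N <= j)%N -> e (v j) <= c) -> e z <= c].
Proof.
move=> dv vD [B vB]; have Pv j := (dv j).1.
(* A transport plan with base [v j] has an optimal coupling of [v j] and [v j.+1] as marginal, so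
   the costs equal the squared distances. *)
have gP j : exists g, optimal_coupling g (v j) (v j.+1).
  have [w [[[g [og _]] _] _]] := Econv (Pv j.+1) (Pv j.+1) (Pv j).
  by exists g.
have [g gH] := choice gP.
have [||z [C C0 vz]] := @W2sq_complete R d v g.
- by move=> j; exact: (gH j).1.
- by move=> j; rewrite (gH j).2 DE// lee_fin.
have Pz : P2 om0 z.
  by apply: (P2_trans (Pv 0%N)); apply: le_lt_trans (vz 0%N) _; exact: ltry.
have vzD j : D (v j) z <= C * 4 ^- j by rewrite -lee_fin -DE.
have dvz eps : 0 < eps -> exists N, forall j, (N <= j)%N -> dist (v j) z <= eps.
  move=> eps0; pose M := C / eps ^+ 2; exists (Num.truncn M) => j Mj.
  rewrite -(ger0_norm (ltW eps0)) -sqrtr_sqr; apply: ler_wsqrtr.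
  apply: le_trans (vzD j) _; rewrite ler_pdivrMr ?exprn_gt0// mulrC -ler_pdivrMr ?exprn_gt0//.
  have Mj' : M <= j.+1%:R by have /ltW/le_trans := truncnS_gt M; apply; rewrite ler_nat.
  by apply: le_trans Mj' _; rewrite -natrX ler_nat ltn_expl.
have W2cvg : W2 (v n) z @[n --> \oo] --> 0%E.
  under eq_fun do rewrite W2E//.
  apply: cvg_EFin; first exact: nearW.
  apply/cvgrPdist_le => eps /dvz[N HN]; exists N => // j /= /HN.
  by rewrite sub0r normrN ger0_norm ?sqrtr_ge0.
have lsc c : (exists N, forall j, (N <= j)%N -> e (v j) <= c) -> (E z <= c%:E)%E.
  move=> [N HN]; apply: le_trans (Elsc Pz Pv W2cvg) _.
  by apply: limn_einf_le; exists N => j Nj; rewrite (EE (dv j)) lee_fin; exact: HN.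
have dz : Dom z.
  split=> //; apply: le_lt_trans (lsc B _) (ltry B); by exists 0%N.
by exists z; split=> // c /lsc; rewrite (EE dz) lee_fin.
Qed.

(** [prox_exists] minimizes over [Dom]; elsewhere in [P2] the functional is [+oo], so [epsilon] does
    pick a minimizer. Its energy is finite by comparison with [u]. *)
Lemma is_prox_J t u : 0 < t -> k * t < 1 -> Dom u -> is_prox Dom D e t u (J om0 E t u).
Proof.
move=> t0 kt du; have Pu := du.1.
have [z [dz zmin]] := prox_exists D_ge0 D_sym D_diag gen_geod (lower_bound du) complete_lsc t0 kt du.
have t20 : 0 < (2 * t)^-1 by rewrite invr_gt0 mulr_gt0.
have [PJ JP] : is_argmin om0 E t u (J om0 E t u).
  apply: ClassicalEpsilon.epsilon_spec; exists z; split=> [|v Pv]; first exact: dz.1.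
  have [Ev|] := ltP (E v) +oo%E.
    have dv : Dom v by [].
    by rewrite (EE dz) (EE dv) !DE//; [rewrite -!EFinM -!EFinD lee_fin; exact: zmin|case: dz].
  rewrite leye_eq => /eqP ->; rewrite addey ?leey//.
  by rewrite DE.
have dJ : Dom (J om0 E t u).
  split=> //; have := JP _ Pu; rewrite W2sq_diag mule0 add0e (EE du) => H.
  rewrite ltey; apply/negP => /eqP EJ; move: H.
  by rewrite EJ addey ?leye_eq// DE.
split=> // v dv; have := JP _ dv.1; rewrite (EE dJ) (EE dv).
by rewrite (DE Pu PJ) (DE Pu dv.1) -!EFinM -!EFinD lee_fin.
Qed.

Lemma Dom_Jn t n u : 0 < t -> k * t < 1 -> Dom u -> Dom (Jn om0 E t n u).
Proof.
by move=> t0 kt du; elim: n => [//|n IH]; exact: (is_prox_J t0 kt IH).1.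
Qed.

Lemma slope_le_Jn t n u S : 0 < t -> k * t < 1 -> Dom u ->
  slope_le Dom D e lam u S -> slope_le Dom D e lam (Jn om0 E t n u) (S / (1 - k * t) ^+ n).
Proof.
move=> t0 kt du uS; elim: n => [|n IH]; first by rewrite expr0 divr1.
have -> : S / (1 - k * t) ^+ n.+1 = S / (1 - k * t) ^+ n / (1 - k * t).
  by rewrite exprS invfM mulrA mulrAC.
apply: (prox_slope_le D_ge0 D_sym D_diag gen_geod t0 kt _ _ IH).
  exact: Dom_Jn.
by apply: is_prox_J => //; exact: Dom_Jn.
Qed.

Lemma slope_ge0 u : (0 <= slope om0 E u)%E.
Proof.
apply: le_ereal_inf_tmp => _ [r [_ ->]]; apply: ereal_sup_ubound; by left.
Qed.

Lemma slope_leP u : Dom u -> (slope om0 E u < +oo)%E ->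
  slope_le Dom D e lam u (fine (slope om0 E u)).
Proof.
move=> du fin; have Pu := du.1.
have SE : (fine (slope om0 E u))%:E = slope om0 E u.
  by rewrite fineK// ge0_fin_numE// slope_ge0.
apply: (slope_le_local D_ge0 D_diag gen_geod) => //.
  by rewrite fine_ge0// slope_ge0.
move=> eps eps0; set S := fine _.
have : (slope om0 E u < (S + eps)%:E)%E by rewrite -SE lte_fin ltrDl.
move=> /ereal_inf_lt[_ [r [r0 ->]] sup_lt]; exists r => // z dz uz; have Pz := dz.1.
(* The slope ignores measures at distance 0; for these, lower semicontinuity along a constant
   sequence gives [e u <= e z]. *)
have [D0|DN0] := eqVneq (dist u z) 0.
  rewrite D0 mulr0 subr_le0 -lee_fin -(EE du) -(EE dz).
  have cvg0 : W2 z u @[_ --> \oo] --> 0%E.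
    by rewrite W2E// D_sym D0; exact: cvg_cst.
  apply: le_trans (Elsc (u := fun=> z) Pu (fun=> Pz) cvg0) _.
  by apply: limn_einf_le; exists 0%N.
have w0 : 0 < dist u z by rewrite lt_def DN0 sqrtr_ge0.
have qle : (maxe (E u - E z) 0 * ((fine (W2 u z))^-1)%:E < (S + eps)%:E)%E.
  apply: le_lt_trans sup_lt; apply: ereal_sup_ubound; right; exists z.
  by rewrite W2E// !lte_fin.
rewrite -ler_pdivrMr// -lee_fin EFinM; apply: le_trans (ltW qle).
rewrite W2E//=; apply: lee_wpmul2r; first by rewrite lee_fin invr_ge0 ltW.
by rewrite (EE du) (EE dz) -EFinB le_max lexx.
Qed.

Lemma W2_asymmetric_recursion h t x y s : 0 < h -> h <= t -> k * t < 1 ->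
  Dom x -> Dom y -> slope_le Dom D e lam y s ->
  (((1 - k * h) ^+ 2)%:E * W2sq (J om0 E t x) (J om0 E h y) <=
   (h / t * (1 - k * t)^-1)%:E * W2sq x y
   + ((t - h) / t)%:E * W2sq y (J om0 E t x) + (h ^+ 2 * s ^+ 2)%:E)%E.
Proof.
move=> h0 ht kt dx dy ys.
have t0 : 0 < t by exact: lt_le_trans h0 ht.
have kh : k * h < 1.
  by apply: le_lt_trans kt; apply: ler_wpM2l => //; rewrite /k /lam_minus le_max lexx.
have px := is_prox_J t0 kt dx; have py := is_prox_J h0 kh dy.
rewrite (DE px.1.1 py.1.1) (DE dx.1 dy.1) (DE dy.1 px.1.1) -!EFinM -!EFinD lee_fin.
exact: (asymmetric_recursion D_ge0 D_sym gen_geod h0 ht kt dx dy px py ys).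
Qed.

End wasserstein_gradient_flow.

Unset Implicit Arguments.

Theorem theorem2p4 (R : realType) (d : nat) (om0 : probability (Rd R d) R)
  (E : probability (Rd R d) R -> \bar R) (lam : R)
                                                                                       
  (E_wd : forall mu nu : probability (Rd R d) R,
     (forall A, measurable A -> mu A = nu A) -> E mu = E nu)
                                     
  (E_noninf : forall mu, P2 om0 mu -> E mu != -oo%E)
  (Eproper : is_proper om0 E) (Ecoer : is_coercive om0 E) (Elsc : is_W2_lsc om0 E)
  (Econv : is_convex_gen_geod om0 E lam)
  (mu : probability (Rd R d) R)
  (mu_dom : P2 om0 mu /\ (E mu < +oo)%E /\ (slope om0 E mu < +oo)%E)
  (h tau : R) (h_pos : 0 < h) (h_le : h <= tau) (tau_lt : lam_minus lam * tau < 1)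
  (n m : nat) (n_ge1 : (1 <= n)%N) (m_ge1 : (1 <= m)%N) :
  (((1 - lam_minus lam * h) ^+ 2)%:E
      * W2sq (Jn om0 E tau n mu) (Jn om0 E h m mu)
   <= (h / tau * (1 - lam_minus lam * tau)^-1)%:E
        * W2sq (Jn om0 E tau n.-1 mu) (Jn om0 E h m.-1 mu)
      + ((tau - h) / tau)%:E * W2sq (Jn om0 E h m.-1 mu) (Jn om0 E tau n mu)
      + (2 * h ^+ 2 * (1 - lam_minus lam * h) ^- (2 * m))%:E
        * (slope om0 E mu * slope om0 E mu))%E.
Proof.
have [Pmu [Emu slope_fin]] := mu_dom.
set k := lam_minus lam in tau_lt *.
have k0 : 0 <= k by rewrite /k /lam_minus le_max lexx.
have tau_pos : 0 < tau by exact: lt_le_trans h_pos h_le.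
have kh : k * h < 1 by apply: le_lt_trans tau_lt; exact: ler_wpM2l.
have dmu : P2 om0 mu /\ (E mu < +oo)%E by [].
have dx p := Dom_Jn E_noninf Ecoer Elsc Econv p tau_pos tau_lt dmu.
have dy p := Dom_Jn E_noninf Ecoer Elsc Econv p h_pos kh dmu.
set S := fine (slope om0 E mu).
have SE : slope om0 E mu = S%:E by rewrite fineK// ge0_fin_numE// slope_ge0.
have muS := slope_leP E_noninf Elsc Econv dmu slope_fin.
case: n n_ge1 => // n' _; case: m m_ge1 => // m' _ /=.
have := W2_asymmetric_recursion E_noninf Ecoer Elsc Econv h_pos h_le tau_lt (dx n') (dy m')
  (slope_le_Jn E_noninf Ecoer Elsc Econv m' h_pos kh dmu muS).
set X' := Jn om0 E tau n' mu; set Y' := Jn om0 E h m' mu.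
rewrite -/k -/S SE -EFinM => /le_trans; apply; apply: leeD2l.
(* The recursion gives the constant 1 and the exponent [2 * m']; since [0 < 1 - k * h <= 1], passing
   to 2 and [2 * m'.+1] only enlarges the bound. *)
have a0 : 0 < 1 - k * h by rewrite subr_gt0.
have a1 : 1 - k * h <= 1 by rewrite lerBlDr lerDl mulr_ge0// ltW.
rewrite lee_fin.
have -> : h ^+ 2 * (S / (1 - k * h) ^+ m') ^+ 2 =
    h ^+ 2 * (S * S) * (1 - k * h) ^- (2 * m').
  by rewrite expr_div_n -expr2 -exprM (mulnC m') mulrA.
have -> : 2 * h ^+ 2 * (1 - k * h) ^- (2 * m'.+1) * (S * S) =
    h ^+ 2 * (S * S) * (2 * (1 - k * h) ^- (2 * m'.+1)) by ring.
apply: ler_wpM2l; first by rewrite mulr_ge0 ?sqr_ge0// -expr2 sqr_ge0.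
have p0 q : 0 < (1 - k * h) ^+ q by rewrite exprn_gt0.
apply: (@le_trans _ _ ((1 - k * h) ^- (2 * m'.+1))).
  by rewrite lef_pV2 ?posrE//; apply: ler_wiXn2l => //; [exact: ltW|rewrite leq_mul2l leqnSn].
by rewrite ler_peMl ?invr_ge0 ?(ltW (p0 _))//; lra.
Qed.
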